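(* Let $D$ be an integral domain which is not a field, and let $\star$ be a semistar operation on $D$. The following are equivalent: (1) $D$ is a $\star$-almost Dedekind domain ($\star$-ADD). (2) $\mathrm{Na}(D,\star)$ is an almost Dedekind domain (i.e. $\mathrm{Na}(D,\star)$ is a 1-dimensional Prüfer domain and contains no idempotent maximal ideals). (3) $\mathrm{Na}(D,\star)=\mathrm{Kr}(D,\star)$ is an almost Dedekind domain and a Bézout domain.
   Context: Let $D$ be an integral domain with quotient field $K$. $\overline{\boldsymbol F}(D)$ denotes the set of all nonzero $D$-submodules of $K$, and $\boldsymbol f(D)$ the set of nonzero finitely generated $D$-submodules of $K$. A semistar operation on $D$ is a map $\star:\overline{\boldsymbol F}(D)\to\overline{\boldsymbol F}(D)$, $E\mapsto E^\star$, such that for all $0\neq x\in K$ and $E,F\in\overline{\boldsymbol F}(D)$: $(xE)^\star=xE^\star$; $E\subseteq F$ implies $E^\star\subseteq F^\star$; $E\subseteq E^\star$ and $(E^\star)^\star=E^\star$. The semistar operation $\star_f$ is defined by $E^{\star_f}:=\bigcup\{F^\star : F\in\boldsymbol f(D),\ F\subseteq E\}$. A quasi-$\star$-ideal of $D$ is a nonzero ideal $I$ of $D$ with $I=I^\star\cap D$. $\mathcal{M}(\star_f)$ is the set of quasi-$\star_f$-maximal ideals, i.e. the maximal elements of the set of all proper quasi-$\star_f$-ideals of $D$ (these are prime ideals). A DVR is a rank-one discrete valuation domain. $D$ is a $\star$-almost Dedekind domain ($\star$-ADD) if $D_M$ is a DVR for each $M\in\mathcal{M}(\star_f)$. An almost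 Dedekind domain (ADD) is the same notion for $\star=d$ the identity operation, i.e. all localizations at maximal ideals are DVRs (a field being, by convention, a trivial example). For a polynomial $h$, $\boldsymbol c(h)$ is its content, i.e. the $D$-submodule of $K$ generated by its coefficients. With $N(\star):=\{h\in D[X] : h\neq 0,\ \boldsymbol c(h)^\star=D^\star\}$ (a multiplicative set), the Nagata ring is $\mathrm{Na}(D,\star):=D[X]_{N(\star)}$. The Kronecker function ring is $\mathrm{Kr}(D,\star):=\{f/g : f,g\in D[X]\setminus\{0\}$ and there exists $h\in D[X]\setminus\{0\}$ with $(\boldsymbol c(f)\boldsymbol c(h))^\star\subseteq(\boldsymbol c(g)\boldsymbol c(h))^\star\}\cup\{0\}$.
   Formalization: In the parenthetical of (2), almost Dedekind is shown equivalent to: Na(D,⋆) is a field, or is a 1-dimensional Prüfer domain with no idempotent maximal ideals; the field case is added since for E^⋆=K the ring Na(D,⋆)=K(X) is a field, of dimension 0. *)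

(* Defs.v *)
From mathcomp Require Import all_boot all_order all_algebra.
From mathcomp Require Import boolp classical_sets.

Set Implicit Arguments.
Unset Strict Implicit.
Unset Printing Implicit Defensive.

Import GRing.Theory.
Local Open Scope ring_scope.
Local Open Scope classical_set_scope.

(* Rings are represented as subrings [A : set L] of a field [L]; their ideals,
   localizations and (fractional) modules are then subsets of [L] as well. *)

Section Subrings.
Variable L : fieldType.
Implicit Types (A V E F I J M P S : set L).

Definition is_subring A : Prop := GRing.subring_closed [in A].

Definition is_field A : Prop :=
  is_subring A /\ forall x, A x -> x != 0 -> A x^-1.

Definition is_submodule A E : Prop :=
  [/\ E 0,
      forall x y, E x -> E y -> E (x + y)
    & forall a x, A a -> E x -> E (a * x)].

Definition nonzero E : Prop := exists2 x, E x & x != 0.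

Definition span A S : set L := smallest (is_submodule A) S.

Definition fin_gen A E : Prop := exists s : seq L, E = span A [set` s].

Definition mul_mod A E F : set L := span A [set x * y | x in E & y in F].

Definition scale (x : L) E : set L := [set x * y | y in E].

Definition is_ideal A I : Prop := is_submodule A I /\ I `<=` A.

Definition is_prime A P : Prop :=
  [/\ is_ideal A P, P <> A
    & forall a b, A a -> A b -> P (a * b) -> P a \/ P b].

Definition is_maximal A M : Prop :=
  [/\ is_ideal A M, M <> A
    & forall J, is_ideal A J -> J <> A -> M `<=` J -> J = M].

Definition localize A S : set L := [set a / s | a in A & s in S].

Definition localize_at A P : set L := localize A (A `\` P).

(* The value [v 0] is irrelevant: [v] is only constrained on nonzero elements,
   where it is a surjective valuation with value group [int]. *)
Definition is_DVR V : Prop :=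
  exists v : L -> int,
    [/\ forall x y, x != 0 -> y != 0 -> v (x * y) = v x + v y,
        forall x y, x != 0 -> y != 0 -> x + y != 0 ->
          (Order.min (v x) (v y) <= v (x + y))%R,
        forall n : int, exists2 x, x != 0 & v x = n
      & V = [set x | x = 0 \/ (x != 0 /\ (0 <= v x)%R)]].

(* By convention, a field is a (trivial) almost Dedekind domain. *)
Definition almost_dedekind A : Prop :=
  is_subring A /\
  (is_field A \/ forall M, is_maximal A M -> is_DVR (localize_at A M)).

Definition is_bezout A : Prop :=
  is_subring A /\
  forall I, is_ideal A I -> fin_gen A I -> exists2 a, A a & I = span A [set a].

Definition invertible A I : Prop :=
  exists2 J, is_submodule A J & mul_mod A I J = A.

Definition is_prufer A : Prop :=
  is_subring A /\
  forall I, is_ideal A I -> nonzero I -> fin_gen A I -> invertible A I.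

Definition prime_chain A (n : nat) : Prop :=
  exists P : nat -> set L,
    (forall i, (i <= n)%N -> is_prime A (P i)) /\
    (forall i, (i < n)%N -> P i `<=` P i.+1 /\ P i <> P i.+1).

Definition krull_dim_is A (n : nat) : Prop :=
  prime_chain A n /\ ~ prime_chain A n.+1.

Definition idempotent_ideal A I : Prop := mul_mod A I I = I.

End Subrings.

Section Semistar.
Variable D : idomainType.
Local Notation K := {fraction D}.

Definition ring_of : set K := range (@tofrac D).

Definition Fbar : set (set K) :=
  [set E | is_submodule ring_of E /\ nonzero E].

Definition fg : set (set K) := [set E | Fbar E /\ fin_gen ring_of E].

(* The axioms say nothing about values outside [Fbar]. *)
Record semistar := Semistar {
  semistar_fun :> set K -> set K;
  semistar_Fbar : forall E, Fbar E -> Fbar (semistar_fun E);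
  semistar_scale : forall x E, x != 0 -> Fbar E ->
    semistar_fun (scale x E) = scale x (semistar_fun E);
  semistar_mono : forall E F, Fbar E -> Fbar F ->
    E `<=` F -> semistar_fun E `<=` semistar_fun F;
  semistar_ext : forall E, Fbar E -> E `<=` semistar_fun E;
  semistar_idem : forall E, Fbar E ->
    semistar_fun (semistar_fun E) = semistar_fun E
}.

Definition star_f (star : set K -> set K) (E : set K) : set K :=
  \bigcup_(F in [set F | fg F /\ F `<=` E]) star F.

Definition quasi_ideal (star : set K -> set K) (I : set K) : Prop :=
  [/\ is_ideal ring_of I, nonzero I & I = star I `&` ring_of].

Definition quasi_maximal (star : set K -> set K) (M : set K) : Prop :=
  [/\ quasi_ideal star M, M <> ring_of
    & forall J, quasi_ideal star J -> J <> ring_of -> M `<=` J -> J = M].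

Definition star_ADD (star : semistar) : Prop :=
  forall M, quasi_maximal (star_f star) M -> is_DVR (localize_at ring_of M).

Definition content (h : {poly D}) : set K :=
  span ring_of [set` map (@tofrac D) h].

(* Both rings live in [{fraction {poly D}}], that is, in K(X). *)

Definition Nstar (star : semistar) : set {poly D} :=
  [set h | h != 0 /\ star (content h) = star ring_of].

Definition Na (star : semistar) : set {fraction {poly D}} :=
  localize (range (@tofrac {poly D})) (@tofrac {poly D} @` Nstar star).

Definition Kr (star : semistar) : set {fraction {poly D}} :=
  [set x | x = 0 \/
    exists f g : {poly D},
      [/\ f != 0, g != 0, x = tofrac f / tofrac g
        & exists2 h : {poly D}, h != 0 &
            star (mul_mod ring_of (content f) (content h)) `<=`
            star (mul_mod ring_of (content g) (content h))]].

End Semistar.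

(* Main.v *)
Require Import Defs.
From mathcomp Require Import all_boot all_order all_algebra.
From mathcomp Require Import boolp classical_sets.
From mathcomp Require Import ring zify.

(** The valuations at M and at M Na live on different fields, K and K(X). An equation a s = t^n s'
    in the ring itself survives the inclusion of D in D[X], and can be recovered from polynomials by
    taking coefficients; this is why orders are never compared through valuations. If there is no
    quasi-star_f-maximal ideal, for instance when star sends every module to K, then N(star)
    contains every nonzero polynomial and Na is the field K(X), of dimension 0. Hence the separate
    field case in the second equivalence. That an almost Dedekind Na is Prüfer is obtained by a
    detour: it makes D a star-ADD, so Kr = Na, so Na is Bézout. For the converse, in a
    one-dimensional Prüfer domain any element of a non-idempotent maximal ideal M that lies outside
    M^2 can serve as t. *)

(* A prime P of A has a discrete valuation ring as localization exactly when
   some t in P satisfies: every nonzero a in A is t^n times a quotient of two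
   elements of A outside P. This form of the property passes between D and the
   Nagata ring Na. Joining polynomials as f + X^n g adds up their contents, so
   an ideal of D[X] that misses N(star) lies in M[X] for some quasi-star_f-maximal
   M, and the nonzero maximal ideals of Na are the extensions M Na. A t as above
   for M also works for M Na, since it divides a polynomial as it divides its
   coefficients. Conversely, as M generates M Na, which is not contained in its
   second symbolic power, some c in M can play the role of t for M Na, and
   comparing coefficients brings this down to D. Finally, if all D_M are DVRs,
   then E^star has the same order at M as the finitely generated E; this gives
   Kr = Na, hence (f, g) Na = (f + X^n g) Na for n > deg f. *)

Section SemistarAlmostDedekind.
Set Implicit Arguments.
Unset Strict Implicit.
Unset Printing Implicit Defensive.
Import Order.TTheory GRing.Theory Num.Theory.
Local Open Scope ring_scope.
Local Open Scope classical_set_scope.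
Local Open Scope quotient_scope.
Local Notation span := Defs.span.

(** * Subrings of a field *)

(** [Zorn_bigcup] also asks for the union of the empty chain, which need not satisfy [P]. Applying
    it to the sets [X] with [P (X]|[I)] turns that union into [I]. *)
Lemma exists_maximal_above T (P : set (set T)) (I : set T) :
    P I ->
    (forall C, C !=set0 -> C `<=` P -> total_on C subset ->
       P (\bigcup_(X in C) X)) ->
  exists M, [/\ P M, I `<=` M & forall B, P B -> M `<=` B -> B = M].
Proof.
move=> PI PU; have [C CP Ctot|M [PM maxM]] := @Zorn_bigcup T [set X | P (X `|` I)].
  have [->|/set0P [X0 CX0]] := eqVneq C set0.
    by rewrite /= bigcup_set0 set0U.
  rewrite /= (_ : _ `|` _ = \bigcup_(X in [set X `|` I | X in C]) X).
    apply: PU.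
    - by exists (X0 `|` I), X0.
    - by move=> _ [X CX <-]; apply: CP.
    - move=> _ _ [X CX <-] [Y CY <-].
      case: (Ctot _ _ CX CY) => XY; [left|right].
        by apply: setSU.
      by apply: setSU.
  apply/seteqP; split=> x.
    case=> [[X CX Xx]|Ix]; first by exists (X `|` I); [exists X|left].
    by exists (X0 `|` I); [exists X0|right].
  by case=> _ [X CX <-] [Xx|Ix]; [left; exists X|right].
exists (M `|` I); split; [exact: PM|exact: subsetUr|].
move=> B PB MB; have BI : B `|` I = B.
  by apply/seteqP; split=> x => [[//|Ix]|?]; [apply: MB; right|left].
have [/subset_trans BM|nBM] := pselect (B `<=` M).
  by apply/seteqP; split=> //; apply: BM => x; left.
exfalso; apply: (maxM B); last by rewrite /= BI.
by split=> // x Mx; apply: MB; left.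
Qed.

(** Meant for lists of generators: a finitely generated module inside the union of a chain lies in
    one member. *)
Lemma chain_seq (T : eqType) (C : set (set T)) (s : seq T) :
    C !=set0 -> total_on C subset -> [set` s] `<=` \bigcup_(X in C) X ->
  exists2 X, C X & [set` s] `<=` X.
Proof.
move=> [X0 CX0] Ctot; elim: s => [_|x s IHs sC]; first by exists X0.
have [X CX sX] : exists2 X, C X & [set` s] `<=` X.
  by apply: IHs => y ys; apply: sC; rewrite /= in_cons (ys : y \in s) orbT.
have [|Y CY Yx] := sC x; first by rewrite /= mem_head.
have [XY|YX] := Ctot _ _ CX CY.
  by exists Y => // y /=; rewrite in_cons => /orP[/eqP->//|/sX/XY].
by exists X => // y /=; rewrite in_cons => /orP[/eqP->|/sX//]; apply: YX.
Qed.

Section Subrings.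
Variables (L : fieldType) (A : set L).
Hypothesis subA : is_subring A.
Implicit Types (E F I J M P S : set L).

Lemma subring1 : A 1.
Proof. by case: subA => /set_mem. Qed.

Lemma subringB x y : A x -> A y -> A (x - y).
Proof. by case: subA => _ AB _ /mem_set Ax /mem_set Ay; apply/set_mem/AB. Qed.

Lemma subringM x y : A x -> A y -> A (x * y).
Proof. by case: subA => _ _ AM /mem_set Ax /mem_set Ay; apply/set_mem/AM. Qed.

Lemma subring0 : A 0.
Proof. by rewrite -(subrr 1); apply: subringB; apply: subring1. Qed.

Lemma subringN x : A x -> A (- x).
Proof. by rewrite -sub0r; apply: subringB; apply: subring0. Qed.

Lemma subringD x y : A x -> A y -> A (x + y).
Proof. by move=> Ax Ay; rewrite -[y]opprK; apply/subringB/subringN. Qed.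

Lemma subringX x n : A x -> A (x ^+ n).
Proof.
by move=> Ax; elim: n => [|n IH]; rewrite ?expr0 ?exprS; [apply: subring1|apply: subringM].
Qed.

Lemma subring_submodule : is_submodule A A.
Proof. by split; [apply: subring0|apply: subringD|apply: subringM]. Qed.

Lemma submodule0 E : is_submodule A E -> E 0. Proof. by case. Qed.

Lemma submoduleD E x y : is_submodule A E -> E x -> E y -> E (x + y).
Proof. by case=> _ + _; apply. Qed.

Lemma submoduleM E a x : is_submodule A E -> A a -> E x -> E (a * x).
Proof. by case=> _ _; apply. Qed.

Lemma submoduleMr E a x : is_submodule A E -> E x -> A a -> E (x * a).
Proof. by rewrite mulrC => mE Ex Aa; apply: submoduleM. Qed.

Lemma submoduleN E x : is_submodule A E -> E x -> E (- x).
Proof.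
by move=> mE Ex; rewrite -mulN1r; apply: submoduleM => //; apply/subringN/subring1.
Qed.

Lemma submoduleB E x y : is_submodule A E -> E x -> E y -> E (x - y).
Proof. by move=> mE Ex Ey; apply: submoduleD => //; apply: submoduleN. Qed.

Lemma submodule_bigcup C : C !=set0 -> total_on C subset ->
    (forall E, C E -> is_submodule A E) ->
  is_submodule A (\bigcup_(E in C) E).
Proof.
move=> [E0 CE0] Ctot mC; split.
- by exists E0 => //; exact: (submodule0 (mC _ CE0)).
- move=> x y [E CE Ex] [F CF Fy]; have [EF|FE] := Ctot _ _ CE CF.
    by exists F => //; exact: (submoduleD (mC _ CF) (EF _ Ex) Fy).
  by exists E => //; exact: (submoduleD (mC _ CE) Ex (FE _ Fy)).
- by move=> a x Aa [E CE Ex]; exists E => //; exact: (submoduleM (mC _ CE) Aa Ex).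
Qed.

Lemma span_submodule S : is_submodule A (span A S).
Proof.
split=> [E [mE _]|x y Sx Sy E SE|a x Aa Sx E SE]; first exact: submodule0.
  by apply: submoduleD (proj1 SE) (Sx _ SE) (Sy _ SE).
exact: submoduleM (proj1 SE) Aa (Sx _ SE).
Qed.

Lemma subset_span S : S `<=` span A S.
Proof. exact: sub_gen_smallest. Qed.

Lemma span_min S E : is_submodule A E -> S `<=` E -> span A S `<=` E.
Proof. exact: smallest_sub. Qed.

Lemma span_mono S S' : S `<=` S' -> span A S `<=` span A S'.
Proof.
by move=> SS'; apply: span_min; [exact: span_submodule|exact: subset_trans SS' (@subset_span _)].
Qed.

Lemma scale_submodule x E : is_submodule A E -> is_submodule A (scale x E).
Proof.
move=> mE; split.
- by exists 0; [exact: submodule0|rewrite mulr0].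
- move=> _ _ [y Ey <-] [z Ez <-]; exists (y + z); last by rewrite mulrDr.
  exact: submoduleD.
- by move=> a _ Aa [y Ey <-]; exists (a * y); [exact: submoduleM|rewrite mulrCA].
Qed.

Lemma span1E x : span A [set x] = scale x A.
Proof.
apply/seteqP; split.
  apply: span_min; first exact/scale_submodule/subring_submodule.
  by move=> _ ->; exists 1; rewrite ?mulr1 //; exact: subring1.
move=> _ [a Aa <-]; rewrite mulrC; apply: (submoduleM (span_submodule _)) => //.
exact: subset_span.
Qed.

Lemma mul_modP E F x y : E x -> F y -> mul_mod A E F (x * y).
Proof. by move=> Ex Fy; apply: subset_span; exists x => //; exists y. Qed.

Lemma mul_mod_min E F G : is_submodule A G ->
  (forall x y, E x -> F y -> G (x * y)) -> mul_mod A E F `<=` G.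
Proof. by move=> mG EFG; apply: span_min => // _ [x Ex [y Fy <-]]; apply: EFG. Qed.

Lemma mul_mod_ring E : is_submodule A E -> mul_mod A E A = E.
Proof.
move=> mE; apply/seteqP; split; first by apply: mul_mod_min => // x y Ex Ay; apply: submoduleMr.
by move=> x Ex; rewrite -(mulr1 x); apply: mul_modP => //; exact: subring1.
Qed.

Lemma ideal1 I : is_ideal A I -> I 1 -> I = A.
Proof.
move=> [mI IA] I1; apply/seteqP; split=> // x Ax.
by rewrite -(mulr1 x); apply: submoduleM.
Qed.

Lemma proper_ideal_maximal I : is_ideal A I -> ~ I 1 ->
  exists2 M, is_maximal A M & I `<=` M.
Proof.
move=> idI nI1.
have [|C C0 CP Ctot|M [[idM nM1] IM maxM]] :=
    @exists_maximal_above L [set J | is_ideal A J /\ ~ J 1] I; first by [].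
- split; last by case=> J /CP[_ nJ1].
  split; last by move=> x [J /CP[[_ JA] _] /JA].
  by apply: submodule_bigcup => // J /CP[[]].
- exists M => //; split=> // [MA|J idJ JA MJ].
    by apply: nM1; rewrite MA; exact: subring1.
  by apply: maxM => //; split=> // /(ideal1 idJ).
Qed.

Lemma maximal_comax M a : is_maximal A M -> A a -> ~ M a ->
  exists m c, [/\ M m, A c & 1 = m + c * a].
Proof.
move=> [[mM MA] nMA maxM] Aa nMa.
pose J := [set x | exists m c, [/\ M m, A c & x = m + c * a]].
have idJ : is_ideal A J.
  split; first split.
  - by exists 0, 0; split; [exact: submodule0|exact: subring0|rewrite mul0r addr0].
  - move=> _ _ [m [c [Mm Ac ->]]] [m' [c' [Mm' Ac' ->]]].
    exists (m + m'), (c + c'); split; [exact: submoduleD|exact: subringD|by ring].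
  - move=> b _ Ab [m [c [Mm Ac ->]]].
    exists (b * m), (b * c); split; [exact: submoduleM|exact: subringM|by ring].
  - move=> _ [m [c [Mm Ac ->]]].
    by apply: subringD; [exact: MA|exact: subringM].
have MJ : M `<=` J.
  by move=> m Mm; exists m, 0; split=> //; [exact: subring0|rewrite mul0r addr0].
have Ja : J a.
  by exists 0, 1; split; [exact: submodule0|exact: subring1|rewrite mul1r add0r].
have [JA|nJA] := pselect (J = A); first by have := subring1; rewrite -{1}JA.
by case: nMa; rewrite -(maxM J).
Qed.

Lemma maximal_prime M : is_maximal A M -> is_prime A M.
Proof.
move=> maxM; have [[mM MA] nMA _] := maxM; split=> // a b Aa Ab Mab.
have [Ma|nMa] := pselect (M a); [by left|right].
have [m [c [Mm Ac m1]]] := maximal_comax maxM Aa nMa.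
rewrite -[b]mul1r m1 mulrDl -mulrA.
by apply: submoduleD => //; [exact: submoduleMr|exact: submoduleM].
Qed.

Lemma zero_prime : is_prime A [set 0].
Proof.
split.
- split; last by move=> _ ->; exact: subring0.
  by split=> // [x y -> ->|a x _ ->] /=; rewrite ?addr0 ?mulr0.
- by move=> A0; have := subring1; rewrite -A0 /= => /eqP; rewrite oner_eq0.
- by move=> a b _ _ /eqP; rewrite mulf_eq0 => /orP[]/eqP; [left|right].
Qed.

Lemma maximal0_field M : is_maximal A M -> M `<=` [set 0] -> is_field A.
Proof.
move=> maxM M0; split=> // x Ax x0.
have [|m [c [/M0 /= -> Ac]]] := maximal_comax maxM Ax.
  by move/M0/eqP; rewrite (negPf x0).
by rewrite add0r => /esym cx; rewrite -(mulr1_eq cx) // invrK.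
Qed.

(** * Discrete valuation rings in terms of uniformizers *)

Section LocalizationAtPrime.
Variable P : set L.
Hypothesis primeP : is_prime A P.

Let mP : is_submodule A P. Proof. by case: primeP => -[]. Qed.
Lemma prime_sub x : P x -> A x. Proof. by case: primeP => -[_ PA _ _]; apply: PA. Qed.

Lemma prime1 : ~ P 1.
Proof. by case: primeP => idP + _ => nP /(ideal1 idP). Qed.

Lemma primeM a b : A a -> A b -> P (a * b) -> P a \/ P b.
Proof. by case: primeP => _ _; apply. Qed.

Lemma primeX a n : A a -> P (a ^+ n) -> P a.
Proof.
move=> Aa; elim: n => [/prime1//|n IHn]; rewrite exprS.
by case/primeM => //; exact: subringX.
Qed.

Lemma off_prime1 : (A `\` P) 1.
Proof. by split; [exact: subring1|exact: prime1]. Qed.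

Lemma off_primeM s s' : (A `\` P) s -> (A `\` P) s' -> (A `\` P) (s * s').
Proof.
by move=> [As nPs] [As' nPs']; split; [exact: subringM|case/primeM].
Qed.

Lemma off_primeX s n : (A `\` P) s -> (A `\` P) (s ^+ n).
Proof. by move=> [As nPs]; split; [exact: subringX|move/primeX => /(_ As)]. Qed.

Lemma off_prime_neq0 s : (A `\` P) s -> s != 0.
Proof. by case=> _ nPs; apply/eqP => s0; apply: nPs; rewrite s0; exact: submodule0. Qed.

(** The exponent [n] is the value of [a], as [s] and [s'] become units of the localization. Its
    uniqueness is not demanded, since it follows from [P t]. *)
Definition uniformizer t : Prop :=
  [/\ P t, t != 0
    & forall a, A a -> a != 0 -> exists n s s',
        [/\ (A `\` P) s, (A `\` P) s' & a * s = t ^+ n * s']].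

Lemma DVR_uniformizer :
  is_DVR (localize_at A P) -> exists t, uniformizer t.
Proof.
case=> v [vM _ vsurj VE].
have v1 : v 1 = 0.
  by apply: (addrI (v 1)); rewrite -vM ?oner_neq0 // mulr1 addr0.
have vV x : x != 0 -> v x^-1 = - v x.
  move=> x0; apply: (addrI (v x)).
  by rewrite -vM ?invr_eq0 // divff // v1 subrr.
have vX x n : x != 0 -> v (x ^+ n) = v x *+ n.
  move=> x0; elim: n => [|n IH]; first by rewrite expr0 v1.
  by rewrite exprS vM ?expf_neq0 // IH mulrS.
have loc a s : A a -> (A `\` P) s -> a != 0 -> 0 <= v (a / s).
  move=> Aa Ws a0; have : localize_at A P (a / s) by exists a => //; exists s.
  rewrite VE => -[/eqP|[] //].
  by rewrite mulf_eq0 invr_eq0 (negPf a0) (negPf (off_prime_neq0 Ws)).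
have vA a : A a -> a != 0 -> 0 <= v a.
  by move=> Aa a0; rewrite -[a]divr1; apply: loc => //; exact: off_prime1.
have vW s : (A `\` P) s -> v s = 0.
  move=> Ws; have s0 := off_prime_neq0 Ws; apply/eqP; rewrite eq_le vA ?andbT //; last by case: Ws.
  rewrite -oppr_ge0 -vV // -[_^-1]mul1r; apply: loc => //; last exact: oner_neq0.
  exact: subring1.
have [x x0 vx] := vsurj 1.
have : localize_at A P x by rewrite VE; right; rewrite vx.
case=> t At [s Ws txs]; have s0 := off_prime_neq0 Ws.
have t0 : t != 0 by apply: contraNneq x0 => t0; rewrite -txs t0 mul0r.
have vt : v t = 1.
  by rewrite -vx -txs vM ?invr_eq0 // vV // (vW s) // oppr0 addr0.
have Pt : P t by apply: contrapT => nPt; have := vW t; rewrite vt => /(_ (conj At nPt)).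
exists t; split=> // a Aa a0; have va0 := vA a Aa a0.
set n := `|v a|%N; have nE : v a = n%:Z by rewrite /n; lia.
have tn0 : t ^+ n != 0 by rewrite expf_neq0.
have vatn : v (a / t ^+ n) = 0.
  by rewrite vM ?invr_eq0 // vV // vX // vt nE natz subrr.
have atn0 : a / t ^+ n != 0 by rewrite mulf_neq0 ?invr_eq0.
have : localize_at A P (a / t ^+ n) by rewrite VE; right; rewrite vatn.
case=> b Ab [r Wr abr]; have r0 := off_prime_neq0 Wr.
have arb : a * r = t ^+ n * b.
  by move: abr => /eqP; rewrite eqr_div // => /eqP; rewrite mulrC => <-; rewrite mulrC.
have b0 : b != 0.
  by apply: contraNneq atn0 => b0; rewrite -abr b0 mul0r.
exists n, r, b; split=> //; split=> // Pb.
have vb : v b = 0.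
  have : v (b / r) = 0 by rewrite abr.
  by rewrite vM ?invr_eq0 // vV // (vW r) // oppr0 addr0.
(* Since [b] has value 0, its inverse is also in the valuation ring, say [c / q]; then [q = c * b]
   would lie in [P]. *)
have : localize_at A P b^-1 by rewrite VE; right; rewrite vV // vb oppr0 invr_eq0.
case=> c Ac [q Wq cq]; have q0 := off_prime_neq0 Wq; case: Wq => _; apply.
suff -> : q = c * b by exact: (submoduleM mP).
by rewrite -[c](divfK q0) cq mulrAC mulVf // mul1r.
Qed.

Lemma uniformizer_DVR t :
    (forall y : L, exists a b, [/\ A a, A b, b != 0 & y = a / b]) ->
  uniformizer t -> is_DVR (localize_at A P).
Proof.
move=> fracA [Pt t0 unif]; have At := prime_sub Pt.
(* [U] is the unit group of the localization. The valuation of [y] will be the only [k] with [y] in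
   [t ^ k] times [U]. *)
pose U := [set u | exists s s', [/\ (A `\` P) s, (A `\` P) s' & u = s / s']].
have U0 u : U u -> u != 0.
  case=> s [s' [Ws Ws' ->]]; rewrite mulf_neq0 ?invr_eq0 //; exact: off_prime_neq0.
have UM u u' : U u -> U u' -> U (u * u').
  case=> s [s' [Ws Ws' ->]] [r [r' [Wr Wr' ->]]].
  by exists (s * r), (s' * r'); split; rewrite ?invfM 1?mulrACA //; exact: off_primeM.
have UV u : U u -> U u^-1.
  by case=> s [s' [Ws Ws' ->]]; exists s', s; split=> //; rewrite invf_div.
have U_loc n u : U u -> localize_at A P (t ^+ n * u).
  case=> s [s' [Ws Ws' ->]]; exists (t ^+ n * s); last by exists s' => //; rewrite mulrA.
  by apply: subringM; [exact: subringX|case: Ws].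
have loc_split x : localize_at A P x -> x != 0 ->
    exists (n : nat) u, U u /\ x = t ^+ n * u.
  case=> a Aa [s Ws <-]; rewrite mulf_eq0 negb_or => /andP[a0 _].
  have [n [r [r' [Wr Wr' arr']]]] := unif a Aa a0.
  have r0 := off_prime_neq0 Wr; have s0 := off_prime_neq0 Ws.
  exists n, (r' / (r * s)); split; first by exists r', (r * s); split=> //; exact: off_primeM.
  by rewrite mulrA -arr'; field; apply/andP.
have [v vP] : exists v : L -> int, forall y, y != 0 -> exists2 u, U u & y = t ^ v y * u.
  suff /choice[v vP] : forall y, exists k : int, y != 0 -> exists2 u, U u & y = t ^ k * u.
    by exists v.
  move=> y.
  have [a [b [Aa Ab b0 ->]]] := fracA y.
  have [->|a0] := eqVneq a 0; first by exists 0; rewrite mul0r eqxx.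
  have A_loc x : A x -> localize_at A P x.
    by move=> Ax; exists x => //; exists 1; [exact: off_prime1|rewrite divr1].
  have [n [u [Uu ->]]] := loc_split a (A_loc a Aa) a0.
  have [m [u' [Uu' ->]]] := loc_split b (A_loc b Ab) b0.
  exists (n%:Z - m%:Z) => _; exists (u / u'); first by apply: UM => //; exact: UV.
  by rewrite expfzDr // -exprnP -exprnN; field; rewrite expf_neq0 // U0.
(* If [k < l], cancelling [t ^ k] leaves a product of elements outside [P] equal to a multiple of
   [t], which is in [P]. *)
have vuniq k u l u' : U u -> U u' -> t ^ k * u = t ^ l * u' -> k = l.
  wlog kl : k u l u' / k < l.
    move=> IH Uu Uu' E; case: (ltgtP k l) => // kl; first exact: IH E.
    by apply/esym; apply: IH (esym E).
  case=> s [s' [Ws Ws' ->]] [r [r' [Wr Wr' ->]]] E; exfalso.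
  have [j jE] : exists j : nat, l = k + 1 + j%:Z by exists `|(l - k - 1)%R|%N; lia.
  have [_] := off_primeM Ws Wr'; apply.
  have s'0 := off_prime_neq0 Ws'; have r'0 := off_prime_neq0 Wr'.
  have tk0 : t ^ k != 0 by rewrite expfz_neq0.
  suff -> : s * r' = t * (t ^+ j * r * s').
    apply: (submoduleMr mP) => //; apply: subringM; last by case: Ws'.
    by apply: subringM; [exact: subringX|case: Wr].
  apply: (mulfI tk0); rewrite mulrA.
  transitivity (t ^ k * (s / s') * (s' * r')); first by field.
  by rewrite E jE !expfzDr // expr1z -exprnP; field.
have vE x k u : x != 0 -> U u -> x = t ^ k * u -> v x = k.
  by move=> x0 Uu xE; have [u' Uu' xE'] := vP x x0; apply: vuniq Uu' Uu _; rewrite -xE'.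
have VE x : x != 0 -> localize_at A P x <-> 0 <= v x.
  move=> x0; split=> [/loc_split/(_ x0)[n [u [Uu xE]]]|].
    by rewrite (vE x n%:Z u).
  have [u Uu xE] := vP x x0; case: (v x) xE => // n xE _; rewrite xE; exact: U_loc.
have vM x y : x != 0 -> y != 0 -> v (x * y) = v x + v y.
  move=> x0 y0; have [u Uu xE] := vP x x0; have [u' Uu' yE] := vP y y0.
  apply: (@vE _ _ (u * u')); [by rewrite mulf_neq0|exact: UM|].
  by rewrite {1}xE {1}yE expfzDr // mulrACA.
have U1 : U 1 by exists 1, 1; rewrite divr1; split=> //; exact: off_prime1.
have vt k : v (t ^ k) = k by apply: (vE _ _ 1); rewrite ?expfz_neq0 ?mulr1.
exists v; split=> //.
- move=> x y x0 y0 xy0.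
  wlog vxy : x y x0 y0 xy0 / v x <= v y.
    move=> IH; case: (leP (v x) (v y)) => xy.
      by have := IH x y x0 y0 xy0 xy; rewrite (min_idPl xy).
    have := IH y x y0 x0; rewrite addrC (min_idPl (ltW xy)); apply=> //; exact: ltW.
  rewrite (min_idPl vxy).
  (* Dividing [x] and [y] by [t ^ v x] puts both in the localization, which is closed under
     addition; this gives the inequality for [x + y]. *)
  have div_loc z : z != 0 -> v x <= v z -> localize_at A P (z / t ^ v x).
    move=> z0 xz; rewrite invr_expz; apply/VE; first by rewrite mulf_neq0 ?expfz_neq0.
    by rewrite vM ?expfz_neq0 // vt; lia.
  suff : localize_at A P ((x + y) / t ^ v x).
    rewrite invr_expz => /VE; rewrite mulf_neq0 ?expfz_neq0 // => /(_ isT).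
    by rewrite vM ?expfz_neq0 // vt; lia.
  have [a Aa [s Ws asE]] := div_loc x x0 (lexx _).
  have [b Ab [r Wr brE]] := div_loc y y0 vxy.
  have s0 := off_prime_neq0 Ws; have r0 := off_prime_neq0 Wr.
  exists (a * r + b * s).
    by apply: subringD; apply: subringM => //; [case: Wr|case: Ws].
  exists (s * r); first exact: off_primeM.
  by rewrite [RHS]mulrDl -asE -brE; field; apply/andP.
- by move=> n; exists (t ^ n); [rewrite expfz_neq0|exact: vt].
- apply/seteqP; split=> x.
    by have [->|x0] := eqVneq x 0; [left|move/(VE _ x0) => vx; right].
  case=> [->|[x0 vx]]; last exact/(VE _ x0).
  by exists 0; [exact: subring0|exists 1; [exact: off_prime1|rewrite mul0r]].
Qed.

End LocalizationAtPrime.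

Lemma uniformizer_factor P t x : is_prime A P -> uniformizer P t -> P x -> x != 0 ->
  exists n s s', [/\ (A `\` P) s, (A `\` P) s' & x * s = t ^+ n.+1 * s'].
Proof.
move=> primeP [_ _ unif] Px x0; have Ax := prime_sub primeP Px.
have [[|n] [s [s' [Ws Ws' xs]]]] := unif x Ax x0; last by exists n, s, s'.
have [_] := Ws'; case; rewrite -[s']mul1r -(expr0 t) -xs.
by case: primeP Ws => -[mP _] _ _ [As _]; exact: (submoduleMr mP).
Qed.

(** Up to factors outside [P], a nonzero [a] in [Q] is [t ^+ n], and a nonzero [p] in [P] is a
    positive power of [t]. So [p ^+ n] is locally a multiple of [a], and primality of [Q] gives
    [Q p]. *)
Lemma uniformizer_prime_eq P Q t : is_prime A P -> uniformizer P t ->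
  is_prime A Q -> Q `<=` P -> ~ (Q `<=` [set 0]) -> Q = P.
Proof.
move=> primeP unif primeQ QP nQ0; apply/seteqP; split=> // p Pp.
have [->|p0] := eqVneq p 0; first by case: primeQ => -[/submodule0].
have {nQ0} [a Qa a0] : exists2 a, Q a & a != 0.
  apply: contrapT => noa; apply: nQ0 => a Qa; apply/eqP.
  by apply/negPn/negP => a0; apply: noa; exists a.
have [mQ AQ]: is_ideal A Q by case: primeQ.
have [_ _ /(_ a (AQ _ Qa) a0)[n [s [s' [[As _] [As' nPs'] as_]]]]] := unif.
have [m [r [r' [[Ar nPr] [Ar' _] pr]]]] := uniformizer_factor primeP unif Pp p0.
have At : A t by case: unif => /(prime_sub primeP).
have Ap := prime_sub primeP Pp.
have Apr := subringM Ap Ar.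
have : Q ((p * r) ^+ n * s').
  have -> : (p * r) ^+ n * s' = t ^+ (m * n) * r' ^+ n * s * a.
    transitivity (t ^+ (m * n) * r' ^+ n * (t ^+ n * s')); last by rewrite -as_; ring.
    by rewrite pr exprMn -exprM mulSn exprD; ring.
  apply: (submoduleM mQ) => //; apply: subringM => //.
  by apply: subringM; exact: subringX.
case/(primeM primeQ (subringX _ Apr) As') => [/(primeX primeQ Apr)|/QP//].
by case/(primeM primeQ Ap Ar) => // /QP.
Qed.

(* [x] divides [y] in the localization of [A] at [P]. *)
Definition local_dvd P x y : Prop :=
  exists s b, [/\ (A `\` P) s, A b & s * y = x * b].

(** This set is the contraction to [A] of the multiples of [x] in the localization. For [x = t ^+ 2]
    with [t] a uniformizer it is the second symbolic power of [P]. *)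
Lemma local_dvd_submodule P x : is_prime A P ->
  is_submodule A [set y | A y /\ local_dvd P x y].
Proof.
move=> primeP; split.
- split; first exact: subring0.
  by exists 1, 0; split; [exact: off_prime1|exact: subring0|rewrite !mulr0].
- move=> y z [Ay [s [b [Ws Ab yE]]]] [Az [r [c [Wr Ac zE]]]].
  split; first exact: subringD.
  have [[As _] [Ar _]] := (Ws, Wr).
  exists (s * r), (r * b + s * c); split; first exact: off_primeM.
    by apply: subringD; exact: subringM.
  transitivity (r * (s * y) + s * (r * z)); first by ring.
  by rewrite yE zE; ring.
- move=> a y Aa [Ay [s [b [Ws Ab yE]]]]; split; first exact: subringM.
  by exists s, (a * b); split=> //; [exact: subringM|rewrite mulrCA yE mulrCA].
Qed.

Lemma uniformizer_not_dvd_square P t : is_prime A P -> uniformizer P t ->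
  ~ local_dvd P (t ^+ 2) t.
Proof.
move=> primeP [Pt t0 _] [s [b [[As nPs] Ab E]]]; apply: nPs.
have -> : s = t * b by apply: (mulIf t0); rewrite E; ring.
by case: primeP => -[mP _] _ _; exact: (submoduleMr mP).
Qed.

Lemma uniformizer_dvd P t x : is_prime A P -> uniformizer P t -> P x ->
  local_dvd P t x.
Proof.
move=> primeP unif Px; have [->|x0] := eqVneq x 0.
  by exists 1, 0; split; [exact: off_prime1|exact: subring0|rewrite !mulr0].
have [n [s [s' [Ws [As' _] E]]]] := uniformizer_factor primeP unif Px x0.
exists s, (t ^+ n * s'); split=> //; last by rewrite mulrC E exprS mulrA.
by apply: subringM => //; apply: subringX; case: unif => /(prime_sub primeP).
Qed.

Lemma uniformizer_associate P t x : is_prime A P -> uniformizer P t -> P x ->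
    ~ local_dvd P (t ^+ 2) x ->
  exists s s', [/\ (A `\` P) s, (A `\` P) s' & x * s = t * s'].
Proof.
move=> primeP unif Px ndvd; have At : A t by case: unif => /(prime_sub primeP).
have [x0|x0] := eqVneq x 0.
  case: ndvd; exists 1, 0; rewrite x0 !mulr0.
  by split=> //; [exact: off_prime1|exact: subring0].
have [[|n] [s [s' [Ws Ws' E]]]] := uniformizer_factor primeP unif Px x0.
  by exists s, s'.
case: ndvd; exists s, (t ^+ n * s'); split=> //; last by rewrite mulrC E !exprS; ring.
by case: Ws' => As' _; apply: subringM => //; exact: subringX.
Qed.

(** The square of [P] lies in the second symbolic power, which misses [t]. *)
Lemma uniformizer_not_idempotent P t : is_prime A P -> uniformizer P t ->
  ~ idempotent_ideal A P.
Proof.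
move=> primeP unif PP; apply: (uniformizer_not_dvd_square primeP unif).
have Pt : P t by case: unif.
suff : mul_mod A P P `<=` [set y | A y /\ local_dvd P (t ^+ 2) y].
  by rewrite PP => /(_ t Pt)[].
apply: mul_mod_min => [|x y Px Py]; first exact: local_dvd_submodule.
split; first by apply: subringM; exact: (prime_sub primeP).
have [s [b [Ws Ab sx]]] := uniformizer_dvd primeP unif Px.
have [r [c [Wr Ac ry]]] := uniformizer_dvd primeP unif Py.
exists (s * r), (b * c); split; [exact: off_primeM|exact: subringM|].
by rewrite mulrACA sx ry; ring.
Qed.

(** * Bézout, Prüfer and almost Dedekind domains *)

Lemma bezout_prufer : is_bezout A -> is_prufer A.
Proof.
case=> _ bezA; split=> // I idI [x Ix x0] fgI; have [a Aa IE] := bezA I idI fgI.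
have a0 : a != 0.
  by move: Ix; rewrite IE span1E => -[b _ xE]; apply: contraNneq x0 => a0; rewrite -xE a0 mul0r.
exists (scale a^-1 A); first exact/scale_submodule/subring_submodule.
rewrite IE span1E; apply/seteqP; split.
  apply: mul_mod_min => [|_ _ [b Ab <-] [c Ac <-]]; first exact: subring_submodule.
  by rewrite mulrACA divff // mul1r; exact: subringM.
move=> b Ab; have -> : b = a * 1 * (a^-1 * b) by rewrite mulr1 mulVKf.
by apply: mul_modP; [exists 1; [exact: subring1|]|exists b].
Qed.

Lemma ADD_uniformizer M : almost_dedekind A -> ~ is_field A -> is_maximal A M ->
  exists t, uniformizer M t.
Proof.
by case=> _ [//|adA] _ maxM; apply: DVR_uniformizer (adA M maxM); exact: maximal_prime.
Qed.

Lemma not_field_maximal : ~ is_field A -> exists M, is_maximal A M.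
Proof.
move=> nfA; have [x [Ax x0 nAx]] : exists x, [/\ A x, x != 0 & ~ A x^-1].
  apply: contrapT => nox; apply: nfA; split=> // x Ax x0.
  by apply: contrapT => nAx; apply: nox; exists x.
have [||M maxM _] := @proper_ideal_maximal (scale x A); last by exists M.
  split; first exact/scale_submodule/subring_submodule.
  by move=> _ [a Aa <-]; exact: subringM.
by case=> a Aa xa; apply: nAx; rewrite (mulr1_eq xa).
Qed.

Lemma ADD_krull_dim : almost_dedekind A -> ~ is_field A -> krull_dim_is A 1.
Proof.
move=> adA nfA; split.
  have [M maxM] := not_field_maximal nfA.
  have primeM := maximal_prime maxM.
  exists (fun i => if i is 0%N then [set 0] else M); split=> [[|i] _|[|i] // _] //.
    exact: zero_prime.
  split=> [_ ->|M0]; first by case: primeM => -[/submodule0].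
  by apply: nfA; apply: maximal0_field maxM _; rewrite -M0.
case=> P [primeP ltP].
have [P01 nP01] := ltP 0%N isT; have [P12 nP12] := ltP 1%N isT.
have [id2 _ _] := primeP 2%N isT.
have [M maxM P2M] := proper_ideal_maximal id2 (prime1 (primeP 2%N isT)).
have [t unif] := ADD_uniformizer adA nfA maxM.
have P1M := subset_trans P12 P2M.
apply: nP12; apply/seteqP; split=> //.
(* [P 1] contains [P 0] strictly, so it is nonzero and already equals [M]; nothing is left for
   [P 2]. *)
rewrite (@uniformizer_prime_eq M (P 1%N) t) //; [exact: maximal_prime|exact: primeP|].
move=> P10; apply: nP01; apply/seteqP; split=> // x /P10 ->.
by case: (primeP 0%N isT) => -[/submodule0].
Qed.

Lemma krull_dim1_prime P M : krull_dim_is A 1 -> is_prime A P -> is_prime A M ->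
  P `<=` M -> P <> M -> P `<=` [set 0].
Proof.
move=> [_ no_chain2] primeP primeM PM nPM; apply: contrapT => nP0; apply: no_chain2.
exists (fun i => if i is i'.+1 then if i' is 0%N then P else M else [set 0]).
split=> [[|[|i]] _|[|[|i]] // _] //; first exact: zero_prime.
split=> [_ ->|P0]; first by case: primeP => -[/submodule0].
by apply: nP0; rewrite -P0.
Qed.

(** The localization is a valuation ring. If [J] is the inverse of the ideal [(x, y)], then
    [1 = x * j1 + y * j2], and one summand is outside [M]. If it is [x * j1], then
    [(x * j1) * y = x * (y * j1)] shows that [x] divides [y] locally; the other case is
    symmetric. *)
Lemma prufer_local_dvd_total M x y : is_prufer A -> is_prime A M ->
  A x -> A y -> x != 0 -> local_dvd M x y \/ local_dvd M y x.
Proof.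
move=> [_ prufA] primeM Ax Ay x0; pose I := span A [set` [:: x; y]].
have Ix : I x by apply: subset_span; rewrite /= mem_head.
have Iy : I y by apply: subset_span; rewrite /= !inE eqxx orbT.
have idI : is_ideal A I.
  split; first exact: span_submodule.
  apply: span_min; first exact: subring_submodule.
  by move=> z /=; rewrite !inE => /orP[]/eqP->.
have [||J mJ IJ] := prufA I idI; [by exists x|by exists [:: x; y]|].
have IJA i j : I i -> J j -> A (i * j) by rewrite -IJ; exact: mul_modP.
have [j1 [j2 [Jj1 Jj2 E]]] : exists j1 j2, [/\ J j1, J j2 & 1 = x * j1 + y * j2].
  pose G := [set z | exists j1 j2, [/\ J j1, J j2 & z = x * j1 + y * j2]].
  suff IJG : mul_mod A I J `<=` G by apply: IJG; rewrite IJ; exact: subring1.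
  have mG : is_submodule A G.
    split.
    - by exists 0, 0; split; [exact: submodule0|exact: submodule0|rewrite !mulr0 addr0].
    - move=> _ _ [i1 [i2 [Ji1 Ji2 ->]]] [k1 [k2 [Jk1 Jk2 ->]]].
      by exists (i1 + k1), (i2 + k2); split; [exact: submoduleD|exact: submoduleD|ring].
    - move=> a _ Aa [i1 [i2 [Ji1 Ji2 ->]]].
      by exists (a * i1), (a * i2); split; [exact: submoduleM|exact: submoduleM|ring].
  apply: mul_mod_min => // i j Ii Jj.
  suff : I `<=` [set i | G (i * j)] by apply.
  apply: span_min.
    split=> [|u v|a u Aa] /=; rewrite ?mul0r ?mulrDl -?mulrA; first exact: (submodule0 mG).
      exact: (submoduleD mG).
    exact: (submoduleM mG).
  move=> z /=; rewrite !inE => /orP[]/eqP->.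
    by exists j, 0; rewrite mulr0 addr0; split=> //; exact: submodule0.
  by exists 0, j; rewrite mulr0 add0r; split=> //; exact: submodule0.
have [Mxj1|nMxj1] := pselect (M (x * j1)); last first.
  left; exists (x * j1), (y * j1); split; [|exact: IJA|ring].
  by split=> //; exact: IJA.
right; exists (y * j2), (x * j2); split; [|exact: IJA|ring].
split=> [|Myj2]; first exact: IJA.
by apply: (prime1 primeM); rewrite E; apply: submoduleD => //; case: primeM => -[].
Qed.

(** Any [a] in [M] outside the square of [M] works. Local divisibility is total, so [a] divides each
    [m] in [M]: otherwise [a] would locally be [m] times an element of [M]. The last hypothesis then
    gives every nonzero element a finite order with respect to [a]. *)
Lemma prufer_uniformizer M : is_prufer A -> is_maximal A M -> ~ (M `<=` [set 0]) ->
    ~ idempotent_ideal A M ->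
    (forall P, is_prime A P -> P `<=` M -> P <> M -> P `<=` [set 0]) ->
  exists t, uniformizer M t.
Proof.
move=> prufA maxM nM0 nidM dimA; have prM := maximal_prime maxM.
have [[mM MA] _ _] := maxM.
have [a Ma nMMa] : exists2 a, M a & ~ mul_mod A M M a.
  apply: contrapT => noa; apply: nidM; apply/seteqP; split.
    by apply: mul_mod_min => // x y Mx My; exact: submoduleM (MA x Mx) My.
  by move=> a Ma; apply: contrapT => nMMa; apply: noa; exists a.
have Aa := MA _ Ma; have mMM := span_submodule [set x * y | x in M & y in M].
have a0 : a != 0 by apply: contra_notN nMMa => /eqP ->; exact: submodule0.
have dvd_a m : M m -> local_dvd M a m.
  move=> Mm; have Am := MA _ Mm.
  have [//|[s [b [[As nMs] Ab E]]]] := prufer_local_dvd_total prufA prM Aa Am a0.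
  have [Mb|nMb] := pselect (M b); last first.
    by exists b, s; split=> //; rewrite mulrC -E mulrC.
  (* Here [s * a = m * b] is in the square of [M]. As [s] is invertible modulo [M], so is [a]
     itself. *)
  case: nMMa; have [m' [c [Mm' Ac E1]]] := maximal_comax maxM As nMs.
  have -> : a = m' * a + c * (m * b) by rewrite -E; rewrite -[LHS]mul1r E1; ring.
  apply: (submoduleD mMM); first exact: mul_modP.
  by apply: (submoduleM mMM) => //; exact: mul_modP.
(* The intersection of the powers of the principal ideal generated by [a] in
   the localization at [M] contracts to a prime strictly below [M], hence to 0. *)
pose P := [set x | forall n, A x /\ local_dvd M (a ^+ n) x].
have mP : is_submodule A P.
  have mQ n := local_dvd_submodule (a ^+ n) prM.
  split=> [n|x y Px Py n|b x Ab Px n].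
  - exact: (submodule0 (mQ n)).
  - exact: (submoduleD (mQ n) (Px n) (Py n)).
  - exact: (submoduleM (mQ n) Ab (Px n)).
have order x : A x -> ~ P x ->
    exists n s b, [/\ (A `\` M) s, (A `\` M) b & x * s = a ^+ n * b].
  move=> Ax nPx.
  have [n ndvd] : exists n, ~ local_dvd M (a ^+ n) x.
    apply: contrapT => nondvd; apply: nPx => n; split=> //.
    by apply: contrapT => ndvd; apply: nondvd; exists n.
  elim: n ndvd => [|n IHn] ndvd.
    case: ndvd; exists 1, x; rewrite expr0 !mul1r.
    by split=> //; exact: off_prime1.
  have [[s [b [Ws Ab E]]]|/IHn//] := pselect (local_dvd M (a ^+ n) x).
  exists n, s, b; split=> //; last by rewrite mulrC.
  (* If the cofactor [b] were in [M], it would be divisible by [a], and [a ^+ n.+1] would divide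
     [x]. *)
  split=> // /dvd_a[r [c [Wr Ac E']]]; apply: ndvd.
  exists (s * r), c; split=> //; first exact: off_primeM.
  transitivity (r * (s * x)); first by ring.
  by rewrite E mulrCA E' exprSr; ring.
have PM : P `<=` M.
  move=> x /(_ 1%N)[Ax [s [b [[As nMs] Ab E]]]].
  have : M (s * x) by rewrite E expr1; exact: submoduleMr.
  by case/(primeM prM As Ax).
have nP_order x n s b : (A `\` M) s -> (A `\` M) b -> x * s = a ^+ n * b -> ~ P x.
  move=> Ws Wb E /(_ n.+1)[_ [r [c [Wr Ac E']]]].
  have an0 : a ^+ n != 0 by rewrite expf_neq0.
  have [_] := off_primeM prM Wr Wb; apply.
  have -> : r * b = a * (c * s).
    apply: (mulfI an0); transitivity (r * (a ^+ n * b)); first by ring.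
    by rewrite -E mulrA E' exprSr; ring.
  by apply: submoduleMr => //; apply: subringM => //; case: Ws.
have primeP : is_prime A P.
  split; first by split=> // x /PM/MA.
    by move=> PA; apply: (prime1 prM); apply: PM; rewrite PA; exact: subring1.
  move=> x y Ax Ay Pxy; have [|/(order x Ax)[n [s [b [Ws Wb E]]]]] := pselect (P x); first by left.
  have [|/(order y Ay)[m [r [c [Wr Wc E']]]]] := pselect (P y); first by right.
  exfalso; apply: (@nP_order (x * y) (n + m) (s * r) (b * c)) Pxy.
  - exact: off_primeM.
  - exact: off_primeM.
  - by rewrite mulrACA E E' exprD mulrACA.
have nPa : ~ P a.
  by apply: (@nP_order a 1 1 1); rewrite ?expr1 //; exact: off_prime1.
have P0 : P `<=` [set 0] by apply: dimA => // PEM; apply: nPa; rewrite PEM.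
exists a; split=> // x Ax x0; apply: order => // /P0 /eqP.
by rewrite (negPf x0).
Qed.

Lemma prufer_almost_dedekind :
    (forall y : L, exists a b, [/\ A a, A b, b != 0 & y = a / b]) ->
    krull_dim_is A 1 -> is_prufer A ->
    (forall M, is_maximal A M -> ~ idempotent_ideal A M) ->
  almost_dedekind A.
Proof.
move=> fracA dimA prufA nidA; split=> //.
have [|nfA] := pselect (is_field A); [by left|right=> M maxM].
have primeM := maximal_prime maxM.
have [||P primeP|t unif] := @prufer_uniformizer M prufA maxM.
- by move=> M0; apply: nfA; exact: maximal0_field M0.
- exact: nidA.
- exact: krull_dim1_prime.
- exact: uniformizer_DVR unif.
Qed.

End Subrings.

(** * Quasi-star-ideals and contents *)

Lemma fractionP (R : idomainType) (x : {fraction R}) :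
  exists a b : R, b != 0 /\ x = tofrac a / tofrac b.
Proof.
elim/quotW: x => x; exists \n_x, \d_x; have dx0 := denom_ratioP x; split=> //.
have tdx0 : tofrac \d_x != 0 by rewrite tofrac_eq0.
apply: (mulIf tdx0); rewrite divfK //; rewrite !piE.
apply/eqmodP; rewrite /= equivfE.
rewrite /FracField.mulf !numden_Ratio ?oner_neq0 ?mulf_neq0 ?oner_neq0 //.
by apply/eqP; ring.
Qed.

Lemma range_subring (R : comNzRingType) (F : fieldType) (f : {rmorphism R -> F}) :
  is_subring (range f).
Proof.
split; first by rewrite inE /=; exists 1 => //; exact: rmorph1.
  by move=> x y; rewrite !inE /= => -[a _ <-] [b _ <-]; exists (a - b) => //; exact: rmorphB.
by move=> x y; rewrite !inE /= => -[a _ <-] [b _ <-]; exists (a * b) => //; exact: rmorphM.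
Qed.

Section StarIdeals.
Variables (D : idomainType) (star : semistar D).
Local Notation K := {fraction D}.
Local Notation DK := (@ring_of D).
Local Notation sf := (star_f star).
Implicit Types (E F I J M : set K) (f g h : {poly D}).

Let subD : is_subring DK := range_subring (@tofrac D).

Lemma ring_of_tofrac (d : D) : DK (tofrac d). Proof. by exists d. Qed.

Lemma fg_span (s : seq K) x : x \in s -> x != 0 -> fg (span DK [set` s]).
Proof.
move=> xs x0; split; last by exists s.
by split; [exact: span_submodule|exists x => //; exact: subset_span].
Qed.

Lemma fg_join E F G : is_submodule DK E -> fg F -> F `<=` E -> fg G -> G `<=` E ->
  exists H, [/\ fg H, F `<=` H, G `<=` H & H `<=` E].
Proof.
move=> mE [[mF [x Fx x0]] [s FE]] FsubE [[mG _] [r GE]] GsubE.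
exists (span DK [set` s ++ r]).
have sF : F `<=` span DK [set` s ++ r].
  by rewrite FE; apply: span_mono => // y /= ys; rewrite mem_cat ys.
split=> //.
- split; last by exists (s ++ r).
  by split; [exact: span_submodule|exists x => //; exact: sF].
- by rewrite GE; apply: span_mono => // y /= ys; rewrite mem_cat ys orbT.
apply: span_min => // y /=; rewrite mem_cat => /orP[ys|yr].
  by apply: FsubE; rewrite FE; exact: subset_span.
by apply: GsubE; rewrite GE; exact: subset_span.
Qed.

Lemma fg_Fbar E : fg E -> Fbar E. Proof. by case. Qed.

Lemma fg_scale a F : a != 0 -> fg F -> fg (scale a F).
Proof.
move=> a0 fgF.
have [[mF [y Fy y0]] [s Fs]] := fgF; split.
  split; first exact: scale_submodule.
  by exists (a * y); [exists y|rewrite mulf_neq0].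
exists [seq a * z | z <- s]; apply/seteqP; split.
  move=> _ [z Fz <-]; suff : F `<=` [set z | span DK [set` [seq a * z | z <- s]] (a * z)] by apply.
  rewrite Fs; have mS := @span_submodule _ DK [set` [seq a * z | z <- s]].
  apply: span_min => [|u us].
    split=> [|u v|c u Dc] /=; rewrite ?mulr0 ?mulrDr 1?mulrCA; first exact: (submodule0 mS).
      exact: (submoduleD mS).
    exact: (submoduleM mS).
  by apply: subset_span; rewrite /= map_f.
apply: span_min; first exact: scale_submodule.
by move=> _ /= /mapP[z zs ->]; exists z => //; rewrite Fs; exact: subset_span.
Qed.

(** The union defining [star_f] is directed, so one [F] serves finitely many elements at once. Both
    the additivity and the idempotence of [star_f] rest on this. *)
Lemma star_f_seq E (s : seq K) : Fbar E -> [set` s] `<=` sf E ->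
  exists F, [/\ fg F, F `<=` E & [set` s] `<=` star F].
Proof.
move=> [mE [x0 Ex0 nx0]]; elim: s => [_|x s IHs sE].
  (* Members of [fg] are nonzero, so even the empty list needs a generator. *)
  exists (span DK [set` [:: x0]]); split=> //; first exact: (fg_span (mem_head _ _)).
  by apply: span_min => // y /=; rewrite inE => /eqP->.
have [F [fgF FE sF]] : exists F, [/\ fg F, F `<=` E & [set` s] `<=` star F].
  by apply: IHs => y ys; apply: sE; rewrite /= in_cons (ys : y \in s) orbT.
have [|G [fgG GE] Gx] := sE x; first by rewrite /= mem_head.
have [H [fgH FH GH HE]] := fg_join mE fgF FE fgG GE.
exists H; split=> // y /=; rewrite in_cons => /orP[/eqP->|ys].
  exact: (semistar_mono (fg_Fbar fgG) (fg_Fbar fgH) GH Gx).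
exact: (semistar_mono (fg_Fbar fgF) (fg_Fbar fgH) FH (sF _ ys)).
Qed.

Lemma star_f_mono E F : E `<=` F -> sf E `<=` sf F.
Proof. by move=> EF x [G [fgG GE] Gx]; exists G => //; split=> //; exact: subset_trans GE EF. Qed.

Lemma star_f_fg E : fg E -> sf E = star E.
Proof.
move=> fgE; apply/seteqP; split=> [x [F [fgF FE]]|x Ex]; last by exists E => //; split.
exact: (semistar_mono (fg_Fbar fgF) (fg_Fbar fgE) FE).
Qed.

Lemma star_f_ext E : Fbar E -> E `<=` sf E.
Proof.
(* The second generator [y] keeps [F] nonzero when [x = 0]. *)
move=> [mE [y Ey y0]] x Ex; pose F := span DK [set` [:: y; x]].
have fgF : fg F by apply: fg_span y0; exact: mem_head.
exists F.
  by split=> //; apply: span_min => // z /=; rewrite !inE => /orP[]/eqP->.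
by apply: semistar_ext; [exact: fg_Fbar|apply: subset_span; rewrite /= !inE eqxx orbT].
Qed.

Lemma star_f_submodule E : Fbar E -> is_submodule DK (sf E).
Proof.
move=> FbE; have [mE _] := FbE; have starS F : fg F -> is_submodule DK (star F).
  by move=> /fg_Fbar/(semistar_Fbar star)[].
split.
- by apply: star_f_ext => //; exact: (submodule0 mE).
- move=> x y Ex Ey; have [|F [fgF FE sF]] := @star_f_seq E [:: x; y] FbE.
    by move=> z /=; rewrite !inE => /orP[]/eqP->.
  exists F => //; apply: (submoduleD (starS F fgF)); apply: sF => /=.
    exact: mem_head.
  by rewrite !inE eqxx orbT.
- move=> a x Da [F [fgF FE] Fx]; exists F => //; exact: (submoduleM (starS F fgF)).
Qed.

Lemma star_f_idem E : Fbar E -> sf (sf E) = sf E.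
Proof.
move=> FbE; have mE := star_f_submodule FbE.
have FbsE : Fbar (sf E).
  by split=> //; case: (FbE) => _ [x Ex x0]; exists x => //; exact: star_f_ext.
apply/seteqP; split; last exact: star_f_ext.
move=> x [F [fgF FE] Fx]; have [FbF [s Fs]] := fgF.
have [|G [fgG GE sG]] := @star_f_seq E s FbE.
  by apply: subset_trans FE; rewrite Fs; exact: subset_span.
exists G => //; have FbG := fg_Fbar fgG; have FbsG := semistar_Fbar star FbG.
rewrite -(semistar_idem star FbG); apply: (semistar_mono FbF FbsG _ Fx).
by rewrite Fs; apply: span_min => //; case: FbsG.
Qed.

Lemma quasi_ideal_star_f E : Fbar E -> E `<=` DK -> quasi_ideal sf (sf E `&` DK).
Proof.
move=> FbE ED; have mE := star_f_submodule FbE.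
have EI : E `<=` sf E `&` DK by move=> x Ex; split; [exact: star_f_ext|exact: ED].
have mI : is_submodule DK (sf E `&` DK).
  split; first by split; [exact: (submodule0 mE)|exact: subring0].
    by move=> x y [Ex Dx] [Ey Dy]; split; [exact: (submoduleD mE)|exact: subringD].
  by move=> a x Da [Ex Dx]; split; [exact: (submoduleM mE)|exact: subringM].
have nzI : nonzero (sf E `&` DK).
  by case: FbE => _ [x Ex x0]; exists x => //; exact: EI.
split; [by split=> // x []|exact: nzI|].
apply/seteqP; split=> [x Ix|x [Ix Dx]].
  by split; [exact: (star_f_ext (conj mI nzI))|case: Ix].
split=> //; rewrite -(star_f_idem FbE); move: x Ix {Dx}; apply: star_f_mono.
by move=> x [].
Qed.

(** Zorn's lemma above the quasi-ideal generated by [E]. It applies to [star_f] because of its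
    finite type: an element of the closure of the union of a chain comes from a finitely generated
    [F], which lies in one member [J], so the element is already in the closure of [J]. *)
Lemma quasi_maximal_above E : Fbar E -> E `<=` DK -> ~ sf E 1 ->
  exists2 M, quasi_maximal sf M & E `<=` M.
Proof.
move=> FbE ED nE1; have qI := quasi_ideal_star_f FbE ED.
have [|C C0 CP Ctot|M [[qM nM1] IM maxM]] :=
    @exists_maximal_above K [set J | quasi_ideal sf J /\ ~ J 1] (sf E `&` DK).
- by split=> // -[].
- have mU : is_submodule DK (\bigcup_(X in C) X).
    by apply: submodule_bigcup => // J /CP[[[]]].
  have UD : \bigcup_(X in C) X `<=` DK by move=> x [J /CP[[[_ JD] _ _] _] /JD].
  have nzU : nonzero (\bigcup_(X in C) X).
    case: (C0) => J CJ; have [[_ [x Jx x0] _] _] := CP _ CJ.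
    by exists x => //; exists J.
  split; last by case=> J /CP[_ nJ1].
  split=> //; apply/seteqP; split=> x.
    by move=> Ux; split; [exact: star_f_ext|exact: UD].
  case=> -[F [fgF FU] Fx] Dx; have [FbF [s FE]] := fgF.
  have [|J CJ sJ] := chain_seq (s := s) C0 Ctot.
    by apply: subset_trans FU; rewrite FE; exact: subset_span.
  have [[[mJ _] _ JE] _] := CP _ CJ; exists J => //; rewrite JE; split=> //.
  by exists F => //; split=> //; rewrite FE; exact: span_min.
- exists M; last by move=> x Ex; apply: IM; split; [exact: star_f_ext|exact: ED].
  split=> //; first by move=> MD; apply: nM1; rewrite MD; exact: subring1.
  by move=> J qJ nJ MJ; apply: maxM => //; split=> // J1; case: qJ => /ideal1 /(_ J1).
Qed.

Lemma quasi_ideal_star I x : quasi_ideal sf I -> sf I x -> DK x -> I x.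
Proof. by case=> _ _ IE Ix Dx; rewrite IE. Qed.

(** For [a] outside [M], the colon ideal [J] of [M] by [a] contains [M], is proper, and is again a
    quasi-ideal; by maximality it equals [M]. *)
Lemma quasi_maximal_prime M : quasi_maximal sf M -> is_prime DK M.
Proof.
move=> [qM nMD maxM]; have [[mM MD] nzM ME] := qM; split=> // a b Da Db Mab.
have [Ma|nMa] := pselect (M a); [by left|right].
have a0 : a != 0 by apply: contra_notN nMa => /eqP->; exact: (submodule0 mM).
pose J := [set x | DK x /\ M (a * x)].
have mJ : is_submodule DK J.
  split; first by split; [exact: subring0|rewrite mulr0; exact: (submodule0 mM)].
    move=> x y [Dx Mx] [Dy My]; split; first exact: subringD.
    by rewrite mulrDr; exact: (submoduleD mM).
  move=> c x Dc [Dx Mx]; split; first exact: subringM.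
  by rewrite mulrCA; exact: (submoduleM mM).
have MJ : M `<=` J by move=> x Mx; split; [exact: MD|exact: (submoduleM mM Da)].
have FbJ : Fbar J by split=> //; case: nzM => x Mx x0; exists x => //; exact: MJ.
suff <- : J = M by split.
apply: maxM => //; last first.
  by move=> JD; apply: nMa; have := subring1 subD; rewrite -[X in X 1]JD => -[_]; rewrite mulr1.
split; [by split=> // x []|by case: FbJ|].
apply/seteqP; split=> [x Jx|x [[F [fgF FJ] Fx] Dx]].
  by split; [exact: (star_f_ext FbJ)|case: Jx].
split=> //; apply: quasi_ideal_star qM _ (subringM subD Da Dx).
(* The closure commutes with scaling, so [a * x] is in the star-closure of [scale a F], a finitely
   generated submodule of [M]. *)
exists (scale a F); last by rewrite semistar_scale //; [exists x|exact: fg_Fbar].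
split; last by move=> _ [y /FJ[_ May] <-].
exact: fg_scale.
Qed.

(* [M[X]] *)
Definition extension M : set {poly D} := [set f | forall i, M (tofrac f`_i)].

Lemma extensionD M f g : is_submodule DK M -> extension M f -> extension M g ->
  extension M (f + g).
Proof. by move=> mM Mf Mg i; rewrite coefD rmorphD; exact: (submoduleD mM (Mf i) (Mg i)). Qed.

Lemma extensionM M f g : is_submodule DK M -> extension M f -> extension M (f * g).
Proof.
move=> mM Mf i; rewrite coefM rmorph_sum; apply: (big_ind M).
- exact: (submodule0 mM).
- by move=> x y; exact: (submoduleD mM).
- by move=> j _; rewrite rmorphM; apply: (submoduleMr mM (Mf j)); exact: ring_of_tofrac.
Qed.

Lemma extensionC M (d : D) : is_submodule DK M ->
  extension M d%:P <-> M (tofrac d).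
Proof.
move=> mM; split=> [/(_ 0%N)|Md i]; first by rewrite coefC.
by rewrite coefC; case: ifP => // _; rewrite rmorph0; exact: (submodule0 mM).
Qed.

(** Gauss's argument: if [f]_i[and]g[_j] are the first coefficients outside [M], the coefficient of
    index [i + j] of the product is [f]_i * g[_j] modulo [M]. *)
Lemma extension_prime M f g : is_prime DK M -> extension M (f * g) ->
  extension M f \/ extension M g.
Proof.
move=> prM Mfg; have [[mM MD] _ _] := prM.
have first_off h : ~ extension M h ->
    exists i, ~ M (tofrac h`_i) /\ forall j, (j < i)%N -> M (tofrac h`_j).
  move=> nMh; have exi : exists i, `[< ~ M (tofrac h`_i) >].
    apply: contrapT => noi; apply: nMh => i; apply: contrapT => nMi; apply: noi.
    by exists i; exact/asboolP.
  exists (ex_minn exi); case: ex_minnP => i /asboolP nMi mini; split=> // j ji.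
  by apply: contrapT => /asboolP /mini; rewrite leqNgt ji.
have [|/first_off[i [nMfi minf]]] := pselect (extension M f); first by left.
have [|/first_off[j [nMgj ming]]] := pselect (extension M g); first by right.
have ij : (i < (i + j).+1)%N by rewrite ltnS leq_addr.
have := Mfg (i + j)%N; rewrite coefM (bigD1 (Ordinal ij)) //= addKn rmorphD rmorphM.
set rest := (X in _ + X) => Mij; exfalso.
have Mrest : M rest.
  rewrite /rest rmorph_sum; apply: (big_ind M).
  - exact: (submodule0 mM).
  - by move=> x y; exact: (submoduleD mM).
  - move=> k /eqP kij; rewrite rmorphM.
    have : k != i :> nat by apply/eqP => ki; apply: kij; exact: val_inj.
    rewrite neq_ltn => /orP[ki|ik].
      by apply: (submoduleMr mM (minf _ ki)); exact: ring_of_tofrac.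
    by apply: (submoduleM mM); [exact: ring_of_tofrac|apply: ming; have := ltn_ord k; lia].
have := submoduleB subD mM Mij Mrest; rewrite addrK.
by case/(primeM prM (ring_of_tofrac _) (ring_of_tofrac _)).
Qed.

(** * Contents and the multiplicative set N(star) *)

Lemma content_coef f i : content f (tofrac f`_i).
Proof.
have [fi|fi] := ltnP i (size f); last first.
  by rewrite nth_default // rmorph0; exact: (submodule0 (@span_submodule _ DK _)).
by apply: subset_span; rewrite /= map_f // mem_nth.
Qed.

Lemma content_min E f : is_submodule DK E -> extension E f -> content f `<=` E.
Proof. by move=> mE Ef; apply: span_min => // x /= /mapP[d /(nthP 0)[i _ <-] ->]. Qed.

Lemma content_mono f g : (forall i, exists j, f`_i = g`_j) -> content f `<=` content g.
Proof.
move=> fg; apply: content_min => [|i]; first exact: span_submodule.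
by have [j ->] := fg i; exact: content_coef.
Qed.

Lemma content_sub f : content f `<=` DK.
Proof. by apply: content_min => [|i]; [exact: subring_submodule|exact: ring_of_tofrac]. Qed.

Lemma fg_content f : f != 0 -> fg (content f).
Proof.
move=> f0; split; last by exists (map (@tofrac D) f).
split; first exact: span_submodule.
by exists (tofrac (lead_coef f)); [exact: content_coef|rewrite tofrac_eq0 lead_coef_eq0].
Qed.

Lemma content1 : content (1 : {poly D}) = DK.
Proof.
apply: (@ideal1 _ DK).
  by split; [exact: span_submodule|exact: content_sub].
by have := @content_coef 1 0%N; rewrite coefC /= rmorph1.
Qed.

Lemma fg_ring : fg DK.
Proof. by rewrite -content1; apply: fg_content; exact: oner_neq0. Qed.

Lemma Nstar_content1 f : f != 0 -> star (content f) 1 -> Nstar star f.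
Proof.
move=> f0 cf1; split=> //; have fgf := fg_content f0.
have Fbf := fg_Fbar fgf; have FbD := fg_Fbar fg_ring.
have Fbsf := semistar_Fbar star Fbf.
apply/seteqP; split; first exact: (semistar_mono Fbf FbD (@content_sub f)).
rewrite -(semistar_idem star Fbf); apply: (semistar_mono FbD Fbsf) => d Dd.
by case: Fbsf => mS _; rewrite -[d]mulr1; exact: (submoduleM mS).
Qed.

Lemma Nstar_off M f : quasi_maximal sf M -> Nstar star f -> ~ extension M f.
Proof.
move=> qM [f0 cf] Mf; have prM := quasi_maximal_prime qM.
have [[mM MD] _ _] := prM; have [qiM _ _] := qM.
apply: (prime1 prM); apply: (quasi_ideal_star qiM); last exact: subring1.
exists (content f); first by split; [exact: fg_content|exact: content_min].
by rewrite cf; apply: (semistar_ext star (fg_Fbar fg_ring)); exact: subring1.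
Qed.

(** N(star) is the complement of the union of the [extension M]. As these are prime, it is closed
    under products, with no need to relate the content of a product to the contents of its
    factors. *)
Lemma NstarP f : f != 0 ->
  Nstar star f <-> forall M, quasi_maximal sf M -> ~ extension M f.
Proof.
move=> f0; split=> [Nf M qM|offM]; first exact: Nstar_off.
apply: contrapT => nNf; have fgf := fg_content f0.
have [||M qM cfM] := quasi_maximal_above (fg_Fbar fgf).
- exact: content_sub.
- by rewrite star_f_fg // => cf1; apply: nNf; exact: Nstar_content1.
- by apply: (offM M qM) => i; apply: cfM; exact: content_coef.
Qed.

Lemma Nstar1 : Nstar star 1.
Proof. by split; [exact: oner_neq0|rewrite content1]. Qed.

Lemma NstarM f g : Nstar star f -> Nstar star g -> Nstar star (f * g).
Proof.
move=> Nf Ng; have [[f0 _] [g0 _]] := (Nf, Ng).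
apply/NstarP; first by rewrite mulf_neq0.
move=> M qM /(extension_prime (quasi_maximal_prime qM))[] Mfg.
  exact: Nstar_off qM Nf Mfg.
exact: Nstar_off qM Ng Mfg.
Qed.

(** The shift by [n] keeps the coefficients of [f] and [g] from overlapping. The conclusions have
    the shape expected by [content_mono]. *)
Lemma coef_join f g n : (size f <= n)%N ->
  (forall i, exists j, f`_i = (f + g * 'X^n)`_j) /\
  (forall i, exists j, g`_i = (f + g * 'X^n)`_j).
Proof.
move=> fn; split=> i; last first.
  exists (n + i)%N; rewrite coefD coefMXn ltnNge leq_addr /= addKn.
  by rewrite (nth_default _ (leq_trans fn (leq_addr i n))) add0r.
have [i_n|n_i] := ltnP i n; first by exists i; rewrite coefD coefMXn i_n addr0.
(* Beyond [n] the coefficient of [f] is 0, so it is matched with a coefficient past the end of the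
   sum. *)
exists (n + size g)%N; rewrite coefD coefMXn ltnNge leq_addr /= addKn.
by rewrite !nth_default ?addr0 // (leq_trans fn) // leq_addr.
Qed.

Lemma ideal_extension (J : set {poly D}) :
    (forall f g, J f -> J g -> J (f + g)) -> (forall f g, J f -> J (f * g)) ->
    (exists2 f, J f & f != 0) -> (forall f, J f -> ~ Nstar star f) ->
  exists2 M, quasi_maximal sf M & J `<=` extension M.
Proof.
move=> JD JM [f0 Jf0 nz0] JN.
pose E := \bigcup_(f in J) content f.
have Ejoin f g : J f -> J g ->
    exists2 h, J h & content f `<=` content h /\ content g `<=` content h.
  move=> Jf Jg; have [fh gh] := coef_join g (leqnn (size f)).
  exists (f + g * 'X^(size f)); first by apply: JD => //; exact: JM.
  by split; exact: content_mono.
have mc f : is_submodule DK (content f) by exact: span_submodule.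
have FbE : Fbar E.
  split; last first.
    exists (tofrac (lead_coef f0)); last by rewrite tofrac_eq0 lead_coef_eq0.
    by exists f0 => //; exact: content_coef.
  split.
  - by exists f0 => //; exact: (submodule0 (mc f0)).
  - move=> x y [f Jf cx] [g Jg cy]; have [h Jh [fh gh]] := Ejoin f g Jf Jg.
    by exists h => //; apply: (submoduleD (mc h)); [exact: fh|exact: gh].
  - by move=> a x Da [f Jf cx]; exists f => //; exact: (submoduleM (mc f)).
have [||M qM EM] := quasi_maximal_above FbE.
- by move=> x [f _]; exact: content_sub.
(* If 1 were in the closure of [E], the finitely many generators of some [F] would all lie in the
   content of a single [f] in [J], and [f] would belong to N(star). *)
- case=> F [[FbF [s FE]] sFE] F1.
  have [f Jf sf_] : exists2 f, J f & [set` s] `<=` content f.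
    have : [set` s] `<=` E by apply: subset_trans sFE; rewrite FE; exact: subset_span.
    elim: s {FE} => [_|x s IHs sE]; first by exists f0.
    have [|f Jf sf_] := IHs.
      by move=> y ys; apply: sE; rewrite /= in_cons (ys : y \in s) orbT.
    have [|g Jg gx] := sE x; first by rewrite /= mem_head.
    have [h Jh [fh gh]] := Ejoin f g Jf Jg; exists h => // y /=.
    by rewrite in_cons => /orP[/eqP->|/sf_/fh//]; exact: gh.
  have Ff : F `<=` content f by rewrite FE; exact: span_min.
  have f_neq0 : f != 0.
    apply/eqP => f_0; case: FbF => _ [x Fx] /eqP; apply.
    have := Ff _ Fx; rewrite f_0 => /(@content_min [set 0] 0) -> //.
      by case: (zero_prime subD) => -[].
    by move=> i; rewrite coef0 rmorph0.
  apply: (JN f Jf); apply: Nstar_content1 => //.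
  exact: (semistar_mono FbF (fg_Fbar (fg_content f_neq0)) Ff).
- by exists M => // f Jf i; apply: EM; exists f => //; exact: content_coef.
Qed.

End StarIdeals.

(** * The Nagata ring *)

Section Nagata.
Variables (D : idomainType) (star : semistar D).
Local Notation K := {fraction D}.
Local Notation DK := (@ring_of D).
Local Notation sf := (star_f star).
Local Notation N := (Nstar star).
Variables (L : fieldType) (tp : {rmorphism {poly D} -> L}).
Hypothesis tp_eq0 : forall f : {poly D}, (tp f == 0) = (f == 0).
Hypothesis tp_fraction : forall x : L, exists f g, g != 0 /\ x = tp f / tp g.

(* Fractions of polynomials are taken in an arbitrary field [L] of fractions of
   [{poly D}]: conversion problems between concrete elements of
   [{fraction {poly D}}] are intractable. *)
Definition Na_in : set L := localize (range tp) (tp @` N).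
Local Notation A := Na_in.
Definition Kr_in : set L :=
  [set x | x = 0 \/
    exists f g : {poly D},
      [/\ f != 0, g != 0, x = tp f / tp g
        & exists2 h : {poly D}, h != 0 &
            star (mul_mod DK (content f) (content h)) `<=`
            star (mul_mod DK (content g) (content h))]].
Local Notation qmax := (quasi_maximal (star_f star)).
Implicit Types (E F I M : set K) (J : set L) (f g h p q : {poly D}) (x y : L).

Let subD : is_subring DK := range_subring (@tofrac D).

Lemma tp_inj : injective tp.
Proof.
by move=> f g /eqP; rewrite -subr_eq0 -rmorphB tp_eq0 subr_eq0 => /eqP.
Qed.

Lemma NaP x : A x <-> exists f h, N h /\ x = tp f / tp h.
Proof.
split=> [[_ [f _ <-] [_ [h Nh <-] <-]]|[f [h [Nh ->]]]]; first by exists f, h.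
by exists (tp f); [exists f|exists (tp h) => //; exists h].
Qed.

Lemma Nstar_neq0 h : N h -> tp h != 0.
Proof. by case; rewrite tp_eq0. Qed.

Lemma Na_frac f h : N h -> A (tp f / tp h).
Proof. by move=> Nh; apply/NaP; exists f, h. Qed.

Lemma Na_poly f : A (tp f).
Proof. by rewrite -[tp f]divr1 -(rmorph1 tp); exact: Na_frac (Nstar1 star). Qed.

Lemma Na_subring : is_subring A.
Proof.
split; first by rewrite inE -(rmorph1 tp); exact: Na_poly.
  move=> x y; rewrite !inE => /NaP[f [h [Nh ->]]] /NaP[g [k [Nk ->]]].
  have [h0 k0] := (Nstar_neq0 Nh, Nstar_neq0 Nk).
  apply/NaP; exists (f * k - g * h), (h * k); split; first exact: NstarM.
  by rewrite rmorphB !rmorphM; field; apply/andP.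
move=> x y; rewrite !inE => /NaP[f [h [Nh ->]]] /NaP[g [k [Nk ->]]].
apply/NaP; exists (f * g), (h * k); split; first exact: NstarM.
by rewrite !rmorphM invfM mulrACA.
Qed.
Let subA := Na_subring.

Lemma Na_fraction y : exists a b, [/\ A a, A b, b != 0 & y = a / b].
Proof.
have [f [g [g0 ->]]] := tp_fraction y.
by exists (tp f), (tp g); split; rewrite ?tp_eq0 //; exact: Na_poly.
Qed.

(* The ideal of the Nagata ring generated by [M]. *)
Definition Na_ext M : set L :=
  [set x | exists f h, [/\ extension M f, N h & x = tp f / tp h]].

(** Membership is independent of the chosen fraction: after cross-multiplying, the extra denominator
    is in N(star), hence outside the prime [extension M], and can be cancelled. *)
Lemma Na_extP M f h : qmax M -> N h -> Na_ext M (tp f / tp h) <-> extension M f.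
Proof.
move=> qM Nh; split=> [[g [k [Mg Nk /eqP]]]|Mf]; last by exists f, h.
have prM := quasi_maximal_prime qM; have [[mM _] _ _] := prM.
rewrite eqr_div ?Nstar_neq0 // -!rmorphM => /eqP/tp_inj fk.
have : extension M (f * k) by rewrite fk; exact: extensionM.
by case/(extension_prime prM) => // /(Nstar_off qM Nk).
Qed.

Lemma Na_ext_poly M f : qmax M -> Na_ext M (tp f) <-> extension M f.
Proof. by move=> qM; rewrite -(Na_extP f qM (Nstar1 star)) rmorph1 divr1. Qed.

Lemma off_Na_ext M f h : qmax M -> N h -> ~ extension M f ->
  (A `\` Na_ext M) (tp f / tp h).
Proof. by move=> qM Nh nMf; split; [exact: Na_frac|move/(Na_extP f qM Nh)]. Qed.

Lemma off_Na_ext_poly M f : qmax M -> ~ extension M f -> (A `\` Na_ext M) (tp f).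
Proof. by move=> qM nMf; split; [exact: Na_poly|move/(Na_ext_poly f qM)]. Qed.

Lemma Na_ext_ideal M : qmax M -> is_ideal A (Na_ext M).
Proof.
move=> qM; have [[mM _] _ _] := quasi_maximal_prime qM.
split; last by move=> _ [f [h [_ Nh ->]]]; exact: Na_frac.
split.
- exists 0, 1; split; [|exact: Nstar1|by rewrite rmorph0 mul0r].
  by move=> i; rewrite coef0 rmorph0; exact: (submodule0 mM).
- move=> _ _ [f [h [Mf Nh ->]]] [g [k [Mg Nk ->]]].
  have [h0 k0] := (Nstar_neq0 Nh, Nstar_neq0 Nk).
  exists (f * k + g * h), (h * k); split; [|exact: NstarM|].
    by apply: extensionD => //; exact: extensionM.
  by rewrite rmorphD !rmorphM; field; apply/andP.
- move=> _ _ /NaP[g [k [Nk ->]]] [f [h [Mf Nh ->]]].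
  exists (f * g), (k * h); split; [exact: extensionM|exact: NstarM|].
  by rewrite !rmorphM invfM mulrACA [tp g * _]mulrC.
Qed.

Lemma Na_ext_neq1 M : qmax M -> ~ Na_ext M 1.
Proof.
move=> qM; rewrite -(rmorph1 tp) => /(Na_ext_poly 1 qM).
exact: Nstar_off qM (Nstar1 star).
Qed.

(** The contraction of [J] to D[X] misses N(star), whose elements are units of the Nagata ring, so
    [ideal_extension] applies to it. *)
Lemma Na_ideal_sub J : is_ideal A J -> ~ J 1 -> ~ (J `<=` [set 0]) ->
  exists2 M, qmax M & J `<=` Na_ext M.
Proof.
move=> [mJ JA] nJ1 nJ0.
have clear x : J x -> exists f h, [/\ N h, J (tp f) & x = tp f / tp h].
  move=> Jx; have /NaP[f [h [Nh xE]]] := JA _ Jx; exists f, h; split=> //.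
  have -> : tp f = tp h * x by rewrite xE mulrC divfK ?Nstar_neq0.
  by apply: (submoduleM mJ) => //; exact: Na_poly.
have [||||M qM JM] := @ideal_extension D star [set f | J (tp f)].
- by move=> f g /= Jf Jg; rewrite rmorphD; exact: (submoduleD mJ).
- by move=> f g /= Jf; rewrite rmorphM; apply: (submoduleMr mJ) => //; exact: Na_poly.
- apply: contrapT => noJ; apply: nJ0 => x /clear[f [h [Nh Jf ->]]] /=.
  have [->|f0] := eqVneq f 0; first by rewrite rmorph0 mul0r.
  by case: noJ; exists f.
- move=> h Jh Nh; apply: nJ1; rewrite -(mulVf (Nstar_neq0 Nh)).
  by apply: (submoduleM mJ) => //; rewrite -[_^-1]mul1r -(rmorph1 tp); exact: Na_frac.
by exists M => // x /clear[f [h [Nh Jf ->]]]; apply/Na_extP => //; exact: JM.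
Qed.

Lemma Na_ext_mono M I : qmax I -> Na_ext M `<=` Na_ext I -> M `<=` DK -> is_submodule DK M ->
  M `<=` I.
Proof.
move=> qI MI MD mM x Mx; have [d _ dx] := MD _ Mx.
have [[mI _] _ _] := quasi_maximal_prime qI.
rewrite -dx; apply/extensionC => //; apply/(Na_ext_poly _ qI)/MI.
exists d%:P, 1; split; [|exact: Nstar1|by rewrite rmorph1 divr1].
by apply/extensionC => //; rewrite dx.
Qed.

Lemma Na_ext_neq0 M : qmax M -> ~ (Na_ext M `<=` [set 0]).
Proof.
move=> qM M0; have [[_ [x Mx x0] _] _ _] := qM.
have [[mM MD] _ _] := quasi_maximal_prime qM; have [d _ dx] := MD _ Mx.
have /M0/eqP : Na_ext M (tp d%:P) by apply/Na_ext_poly => //; apply/extensionC; rewrite ?dx.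
by rewrite tp_eq0 polyC_eq0 -(tofrac_eq0 d) dx (negPf x0).
Qed.

(** A proper ideal above [Na_ext M] lies in some [Na_ext I]. Looking at constants gives [M] inside
    [I], so [I = M]. *)
Lemma Na_ext_maximal M : qmax M -> is_maximal A (Na_ext M).
Proof.
move=> qM; have idM := Na_ext_ideal qM; have nM1 := Na_ext_neq1 qM.
split=> // [MA|J idJ nJA MJ]; first by apply: nM1; rewrite MA; exact: subring1.
have [||I qI JI] := Na_ideal_sub idJ.
- by move/(ideal1 idJ).
- by move=> J0; apply: (Na_ext_neq0 qM); exact: subset_trans MJ J0.
have [[mM MD] _ _] := quasi_maximal_prime qM.
have IM : I = M.
  case: qM => _ _ maxM; apply: maxM; [by case: qI|by case: qI|].
  by apply: Na_ext_mono => //; exact: subset_trans MJ JI.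
by apply/seteqP; split=> //; rewrite -IM.
Qed.

Lemma Na_maximal_ext J : is_maximal A J -> ~ (J `<=` [set 0]) ->
  exists2 M, qmax M & J = Na_ext M.
Proof.
move=> maxJ nJ0; have [idJ _ _] := maxJ; have prJ := maximal_prime subA maxJ.
have [M qM JM] := Na_ideal_sub idJ (prime1 prJ) nJ0; exists M => //.
case: maxJ => _ _ maxJ; apply/esym/maxJ => //; first exact: Na_ext_ideal.
by case: (Na_ext_maximal qM).
Qed.

(** * Transfer of uniformizers between D and its Nagata ring *)

(** The exponent [n] is the least order at [M] of the coefficients of [f], and [s] is a common
    denominator. The induction adds one coefficient at a time. *)
Lemma gauss_factor M (t : D) f : is_prime DK M -> uniformizer DK M (tofrac t) -> f != 0 ->
  exists n (s : D) k,
    [/\ ~ M (tofrac s), ~ extension M k & s%:P * f = (t ^+ n)%:P * k].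
Proof.
move=> prM [Mt t0 unif]; have [[mM MD] _ _] := prM.
have {}unif (c : D) : c != 0 ->
    exists n s s', [/\ ~ M (tofrac s), ~ M (tofrac s') & s * c = t ^+ n * s'].
  move=> c0; have [||n [_ [_ [[[s _ <-] Ms] [[s' _ <-] Ms'] E]]]] := unif (tofrac c).
  - by exists c.
  - by rewrite tofrac_eq0.
  exists n, s, s'; split=> //; apply/eqP; rewrite -(tofrac_eq (s * c)) mulrC.
  by rewrite !rmorphM rmorphXn E.
have offM (a b : D) : ~ M (tofrac a) -> ~ M (tofrac b) -> ~ M (tofrac (a * b)).
  by move=> nMa nMb; rewrite rmorphM => /(primeM prM)[] //; exact: ring_of_tofrac.
elim/poly_ind: f => [|p c IHp]; first by rewrite eqxx.
have [->|c0] := eqVneq c 0; first rewrite addr0.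
  rewrite mulf_eq0 polyX_eq0 orbF => /IHp[n [s [k [nMs nMk E]]]].
  exists n, s, (k * 'X); split=> //; last by rewrite mulrA E mulrA.
  by move=> Mk; apply: nMk => i; have := Mk i.+1; rewrite coefMX.
have [m [r [r' [nMr nMr' E']]]] := unif c c0.
have [-> _|p0 _] := eqVneq p 0.
  exists m, r, r'%:P; rewrite mul0r add0r -!polyCM E'; split=> //.
  by move/(extensionC _ mM).
have [n [s [k [nMs nMk E]]]] := IHp p0.
(* With [p] of order [n] and [c] of order [m], the smaller power of [t] is factored out. One of the
   truncated differences [n - m] and [m - n] is 0, and that summand keeps the cofactor outside
   [extension M]. *)
exists (minn n m), (s * r), ((r * t ^+ (n - m))%:P * k * 'X + (s * r' * t ^+ (m - n))%:P).
split; first exact: offM.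
  move=> Mk'; have [nm|mn] := leqP n m.
    apply: nMk => i; have := Mk' i.+1; rewrite coefD coefMX coefC /= addr0 coefCM.
    move: nm; rewrite /leq => /eqP->; rewrite expr0 mulr1 rmorphM => /(primeM prM).
    by case=> //; exact: ring_of_tofrac.
  have := Mk' 0%N; rewrite coefD coefMX coefC /= add0r.
  have -> : (m - n = 0)%N by lia.
  by rewrite expr0 mulr1; exact: offM.
rewrite mulrDr mulrDr; congr (_ + _).
  transitivity (r%:P * (s%:P * p) * 'X); first by rewrite polyCM; ring.
  rewrite E -[X in t ^+ X](subnKC (geq_minl n m)).
  have -> : (n - minn n m = n - m)%N by lia.
  by rewrite exprD !polyCM; ring.
rewrite -!polyCM; congr (_%:P); transitivity (s * (r * c)); first by ring.
rewrite E' -[X in t ^+ X](subnKC (geq_minr n m)).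
have -> : (m - minn n m = m - n)%N by lia.
by rewrite exprD; ring.
Qed.

Lemma Na_uniformizer M (t : D) : qmax M -> uniformizer DK M (tofrac t) ->
  uniformizer A (Na_ext M) (tp t%:P).
Proof.
move=> qM unif; have prM := quasi_maximal_prime qM; have [[mM MD] _ _] := prM.
have [Mt t0 _] := unif; split.
- by apply/Na_ext_poly => //; exact/extensionC.
- by rewrite tp_eq0 polyC_eq0 -(tofrac_eq0 t).
move=> _ /NaP[f [h [Nh ->]]]; have h0 := Nstar_neq0 Nh.
rewrite mulf_eq0 tp_eq0 negb_or => /andP[f0 _].
have [n [s [k [nMs nMk E]]]] := gauss_factor prM unif f0.
exists n, (tp s%:P), (tp k / tp h); split.
- by apply: off_Na_ext_poly => // /(extensionC _ mM).
- exact: off_Na_ext.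
by rewrite mulrAC -rmorphM [f * _]mulrC E rmorphM polyC_exp rmorphXn mulrA.
Qed.

Lemma star_ADD_uniformizer M : star_ADD star -> qmax M ->
  exists t : D, uniformizer DK M (tofrac t).
Proof.
move=> addD qM; have prM := quasi_maximal_prime qM.
have [t unif] := DVR_uniformizer subD prM (addD M qM).
by have [/(prime_sub prM)[d _ dt] _ _] := unif; exists d; rewrite dt.
Qed.

Lemma star_ADD_Na : star_ADD star -> almost_dedekind A.
Proof.
move=> addD; split=> //; have [|nfA] := pselect (is_field A); [by left|right].
move=> J maxJ; have prJ := maximal_prime subA maxJ.
have [J0|M qM JE] := Na_maximal_ext maxJ.
  by apply: nfA; exact: (maximal0_field subA maxJ J0).
have [t unif] := star_ADD_uniformizer addD qM.
by apply: (uniformizer_DVR subA prJ Na_fraction); rewrite JE; exact: (Na_uniformizer qM unif).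
Qed.

Lemma Na_not_field M : qmax M -> ~ is_field A.
Proof.
move=> qM [_ invA]; apply: (Na_ext_neq0 qM) => x Mx; apply/eqP/negPn/negP => x0.
have [mM MA] := Na_ext_ideal qM; apply: (Na_ext_neq1 qM).
by rewrite -(mulVf x0); apply: (submoduleM mM) => //; apply: invA => //; exact: MA.
Qed.

Lemma Na_star_ADD : almost_dedekind A -> star_ADD star.
Proof.
move=> adA M qM; have prM := quasi_maximal_prime qM; have [[mM MD] _ _] := prM.
have maxM := Na_ext_maximal qM; have prNM := maximal_prime subA maxM.
have [T unif] := ADD_uniformizer subA adA (Na_not_field qM) maxM.
(* If all constants from [M] were locally divisible by [T ^+ 2], so would be everything they
   generate, that is [Na_ext M], including [T]. *)
have [c Mc ndvd] : exists2 c : D, M (tofrac c) & ~ local_dvd A (Na_ext M) (T ^+ 2) (tp c%:P).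
  apply: contrapT => noc.
  have mQ := local_dvd_submodule subA (T ^+ 2) prNM.
  suff NMQ : Na_ext M `<=` [set y | A y /\ local_dvd A (Na_ext M) (T ^+ 2) y].
    apply: (uniformizer_not_dvd_square prNM unif).
    by have [/NMQ[]] := unif.
  move=> _ [f [h [Mf Nh ->]]]; rewrite mulrC.
  apply: (submoduleM mQ); first by rewrite -[_^-1]mul1r -(rmorph1 tp); exact: Na_frac.
  rewrite -[f]coefK poly_def rmorph_sum; apply: (big_ind _ (submodule0 mQ)) => [x y|i _].
    exact: (submoduleD mQ).
  rewrite -mul_polyC rmorphM; apply: (submoduleMr mQ); last exact: Na_poly.
  split; first exact: Na_poly.
  by apply: contrapT => ndvd; apply: noc; exists (f`_i).
have McN : Na_ext M (tp c%:P) by apply/Na_ext_poly => //; exact/extensionC.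
have [S [S' [WS WS' cS]]] := uniformizer_associate subA prNM unif McN ndvd.
have c0 : c != 0.
  apply: contra_notN ndvd => /eqP->; rewrite rmorph0.
  exists 1, 0; rewrite !mulr0; split=> //; first exact: (off_prime1 subA prNM).
  exact: (subring0 subA).
apply: (uniformizer_DVR subD prM (t := tofrac c)).
  move=> y; have [a [b [b0 ->]]] := fractionP y.
  by exists (tofrac a), (tofrac b); split; rewrite ?tofrac_eq0 //; exact: ring_of_tofrac.
split; [exact: Mc|by rewrite tofrac_eq0|move=> _ [d _ <-]; rewrite tofrac_eq0 => d0].
(* In the factorization of [d] by [T], the power [T ^+ n] is traded for [c ^+ n] by means of [cS];
   multiplying by the denominators [h] and [k] leaves polynomials. *)
have [n [p [q [nMp nMq E]]]] : exists n p q,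
    [/\ ~ extension M p, ~ extension M q & d%:P * p = (c ^+ n)%:P * q].
  have [_ _ /(_ (tp d%:P) (Na_poly _))] := unif.
  rewrite tp_eq0 polyC_eq0 => /(_ d0)[n [R [R' [WR WR' dR]]]].
  have [WSn WSn'] := (off_primeX subA prNM n WS, off_primeX subA prNM n WS').
  have [/NaP[p [h [Nh pE]]] nMp] := off_primeM subA prNM WR WSn'.
  have [/NaP[q [k [Nk qE]]] nMq] := off_primeM subA prNM WSn WR'.
  have [h0 k0] := (Nstar_neq0 Nh, Nstar_neq0 Nk).
  exists n, (p * k), (q * h); split.
  - case/(extension_prime prM) => [Mp|]; last exact: (Nstar_off qM Nk).
    by apply: nMp; rewrite pE; exact/Na_extP.
  - case/(extension_prime prM) => [Mq|]; last exact: (Nstar_off qM Nh).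
    by apply: nMq; rewrite qE; exact/Na_extP.
  apply: tp_inj; rewrite polyC_exp !rmorphM rmorphXn /=.
  have -> : tp p = R * S' ^+ n * tp h by rewrite pE divfK.
  have -> : tp q = S ^+ n * R' * tp k by rewrite qE divfK.
  transitivity (tp d%:P * R * S' ^+ n * tp h * tp k); first by ring.
  transitivity ((tp c%:P * S) ^+ n * R' * tp k * tp h); last by rewrite exprMn; ring.
  by rewrite dR cS exprMn; ring.
have coefE i : d * p`_i = c ^+ n * q`_i.
  by have := congr1 (fun f => f`_i) E; rewrite !coefCM.
have [i nMpi] : exists i, ~ M (tofrac p`_i).
  by apply: contrapT => noi; apply: nMp => i; apply: contrapT => nMi; apply: noi; exists i.
have [j nMqj] : exists j, ~ M (tofrac q`_j).
  by apply: contrapT => noi; apply: nMq => j; apply: contrapT => nMj; apply: noi; exists j.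
exists n, (tofrac p`_i), (tofrac q`_i); split.
- by split=> //; exact: ring_of_tofrac.
- split=> [|Mqi]; first exact: ring_of_tofrac.
  have : M (tofrac (p`_i * q`_j)).
    have -> : p`_i * q`_j = q`_i * p`_j.
      have dc0 : d * c ^+ n != 0 by rewrite mulf_neq0 ?expf_neq0.
      apply: (mulfI dc0); transitivity ((d * p`_i) * (c ^+ n * q`_j)); first by ring.
      by rewrite -coefE coefE; ring.
    by rewrite rmorphM; apply: (submoduleMr mM) => //; exact: ring_of_tofrac.
  by rewrite rmorphM => /(primeM prM)[] //; exact: ring_of_tofrac.
- by rewrite -rmorphM coefE rmorphM rmorphXn.
Qed.

(** * Comparison with the Kronecker function ring *)

(** The Nagata ring is the intersection of the localizations of D[X] at the [extension M]. The
    polynomials [p] that multiply [f / g] into it form an ideal containing [g]; contained in no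
    [extension M], this ideal meets N(star). *)
Lemma Na_local f g : g != 0 ->
    (forall M, qmax M -> exists p q, ~ extension M p /\ p * f = q * g) ->
  A (tp f / tp g).
Proof.
move=> g0 locM; have tg0 : tp g != 0 by rewrite tp_eq0.
apply: contrapT => nA.
have [||||M qM JM] := @ideal_extension D star [set p | A (tp p * (tp f / tp g))].
- by move=> p q /= Ap Aq; rewrite rmorphD mulrDl; exact: subringD.
- move=> p q /= Ap; rewrite rmorphM mulrAC; apply: subringM => //; exact: Na_poly.
- by exists g => //=; rewrite mulrCA divff // mulr1; exact: Na_poly.
- move=> h /= Ah Nh; apply: nA; rewrite -[_ / _](mulKf (Nstar_neq0 Nh)).
  by apply: subringM => //; rewrite -[_^-1]mul1r -(rmorph1 tp); exact: Na_frac.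
have [p [q [nMp pf]]] := locM M qM; apply: nMp; apply: JM => /=.
by rewrite mulrA -rmorphM pf rmorphM mulfK //; exact: Na_poly.
Qed.

(** The cancellation needed in [Kr_local], with [e = m - n - 1]: the excess of [m] over [n] leaves
    at least one factor [t] on the right. *)
Lemma cancel_powers (F : fieldType) (t a b c u v y : F) n m l e :
    t != 0 -> a != 0 -> b != 0 -> c != 0 -> (n.+1 + e)%N = m ->
    t ^+ m / b * (t ^+ l / c) * y = t ^+ n / a * u * (t ^+ l / c * v) ->
  u * v * b = t * (t ^+ e * a * y).
Proof.
move=> t0 a0 b0 c0 <- E; have tn0 : t ^+ n != 0 by rewrite expf_neq0.
have tl0 : t ^+ l != 0 by rewrite expf_neq0.
have r0 : t ^+ n * t ^+ l / (a * b * c) != 0.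
  by rewrite !mulf_neq0 ?invr_eq0 ?mulf_neq0.
apply: (mulfI r0).
transitivity (t ^+ n / a * u * (t ^+ l / c * v)); first by field; rewrite a0 b0 c0.
by rewrite -E addSn exprS exprD; field; rewrite a0 b0 c0.
Qed.

(* If the order [n] of [f] at [M] were smaller than the order [m] of [g], a product
   of unit parts of coefficients of [f] and [h] would lie in [t D^star], hence in
   the star_f-closure of [M]. *)
Lemma Kr_local M (t : D) f g h : qmax M -> uniformizer DK M (tofrac t) ->
    f != 0 -> g != 0 -> h != 0 ->
    star (mul_mod DK (content f) (content h)) `<=`
      star (mul_mod DK (content g) (content h)) ->
  exists p q, ~ extension M p /\ p * f = q * g.
Proof.
move=> qM unif f0 g0 h0 starS; have prM := quasi_maximal_prime qM.
have [[mM MD] _ _] := prM; have [Mt t0 _] := unif.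
have [n [s [k [nMs nMk fE]]]] := gauss_factor prM unif f0.
have [m [s' [k' [nMs' nMk' gE]]]] := gauss_factor prM unif g0.
have [l [s'' [k'' [nMs'' nMk'' hE]]]] := gauss_factor prM unif h0.
have offC d : ~ M (tofrac d) -> ~ extension M d%:P by move=> nMd /(extensionC _ mM).
(* If [m <= n], then [g] divides [f] locally, and cross-multiplying [fE] with [gE] gives [p] and
   [q]. *)
have [mn|nm] := leqP m n.
  exists (s%:P * k'), ((t ^+ (n - m))%:P * s'%:P * k); split.
    by case/(extension_prime prM) => //; exact: offC.
  transitivity ((t ^+ n)%:P * k * k'); first by rewrite -fE; ring.
  rewrite -{1}(subnK mn) exprD polyCM.
  transitivity ((t ^+ (n - m))%:P * k * (s'%:P * g)); last by ring.
  by rewrite gE; ring.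
exfalso.
have ex_off p : ~ extension M p -> exists i, ~ M (tofrac p`_i).
  move=> nMp; apply: contrapT => noi; apply: nMp => i; apply: contrapT => nMi.
  by apply: noi; exists i.
have [[i nMki] [j nMkj]] := (ex_off _ nMk, ex_off _ nMk'').
have neq0 d : ~ M (tofrac d) -> tofrac d != 0.
  by apply: contra_notN => /eqP->; exact: (submodule0 mM).
have [s0 [s'0 s''0]] := (neq0 _ nMs, (neq0 _ nMs', neq0 _ nMs'')).
have coefE e (a : D) b p p' : tofrac a != 0 -> a%:P * p = (t ^+ e)%:P * p' ->
    tofrac p`_b = tofrac t ^+ e / tofrac a * tofrac p'`_b.
  move=> a0 /(congr1 (fun f => f`_b)); rewrite !coefCM => E.
  apply: (mulfI a0).
  by rewrite -rmorphM E rmorphM rmorphXn [_ / tofrac a]mulrC -mulrA mulVKf.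
have subC e (a : D) p p' : tofrac a != 0 -> a%:P * p = (t ^+ e)%:P * p' ->
    content p `<=` scale (tofrac t ^+ e / tofrac a) DK.
  move=> a0 E; apply: content_min => [|b]; first exact/scale_submodule/subring_submodule.
  by rewrite (coefE e a b p p') //; exists (tofrac p'`_b) => //; exact: ring_of_tofrac.
(* By [gE] and [hE], the contents of [g] and [h] lie in principal modules; [w] is the product of
   their generators. Hence the closure of the product of the contents lies in [w] times the closure
   of D. *)
pose w := tofrac t ^+ m / tofrac s' * (tofrac t ^+ l / tofrac s'').
have w0 : w != 0 by rewrite !mulf_neq0 ?invr_eq0 ?expf_neq0.
pose E := mul_mod DK (content g) (content h).
have FbE : Fbar E.
  split; first exact: span_submodule.
  exists (tofrac (lead_coef g) * tofrac (lead_coef h)).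
    by apply: mul_modP; exact: content_coef.
  by rewrite mulf_neq0 // tofrac_eq0 lead_coef_eq0.
have FbW : Fbar (scale w DK) by exact/fg_Fbar/(fg_scale w0)/fg_ring.
have EW : E `<=` scale w DK.
  apply: mul_mod_min; first by case: FbW.
  move=> x y /(subC _ _ _ _ s'0 gE)[a Da <-] /(subC _ _ _ _ s''0 hE)[b Db <-].
  by exists (a * b); [exact: subringM|rewrite mulrACA].
have FbD := fg_Fbar (fg_ring D); have [mS _] := semistar_Fbar star FbD.
have starEW : star E `<=` scale w (star DK).
  by rewrite -(semistar_scale star w0 FbD); exact: (semistar_mono FbE FbW EW).
have : star E (tofrac f`_i * tofrac h`_j).
  apply: starS; apply: semistar_ext; last by apply: mul_modP; exact: content_coef.
  split; first exact: span_submodule.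
  exists (tofrac (lead_coef f) * tofrac (lead_coef h)).
    by apply: mul_modP; exact: content_coef.
  by rewrite mulf_neq0 // tofrac_eq0 lead_coef_eq0.
move=> /starEW[y Sy]; rewrite (coefE _ _ _ _ _ s0 fE) (coefE _ _ _ _ _ s''0 hE).
rewrite /w => yE.
have kE : tofrac k`_i * tofrac k''`_j * tofrac s' =
    tofrac t * (tofrac t ^+ (m - n.+1) * tofrac s * y).
  apply: cancel_powers yE => //; exact: subnKC.
(* By [kE] this product lies in the star-closure of [tD], and [tD] is a finitely generated part of
   [M]; as [M] is a quasi-ideal, the product is in [M], although its three factors are not. *)
have : M (tofrac (k`_i * k''`_j * s')).
  have [qiM _ _] := qM; apply: (quasi_ideal_star qiM); last exact: ring_of_tofrac.
  exists (scale (tofrac t) DK).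
    split; first exact: (fg_scale t0 (fg_ring D)).
    by move=> _ [a Da <-]; exact: (submoduleMr mM).
  rewrite (semistar_scale star t0 FbD) !rmorphM kE; exists (tofrac t ^+ (m - n.+1) * tofrac s * y) => //.
  by apply: (submoduleM mS) => //; rewrite -rmorphXn -rmorphM; exact: ring_of_tofrac.
rewrite !rmorphM => /(primeM prM)[]; try exact: ring_of_tofrac; rewrite -?rmorphM //.
  exact: ring_of_tofrac.
by rewrite rmorphM => /(primeM prM)[] //; exact: ring_of_tofrac.
Qed.

Lemma Kr_content f g : f != 0 -> g != 0 -> content f `<=` content g ->
  Kr_in (tp f / tp g).
Proof.
move=> f0 g0 fg; right; exists f, g; split=> //; exists 1; first exact: oner_neq0.
rewrite content1 !mul_mod_ring; try exact: span_submodule; try exact: subD.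
by apply: semistar_mono fg; apply: fg_Fbar; exact: fg_content.
Qed.

Lemma Na_sub_Kr : A `<=` Kr_in.
Proof.
move=> _ /NaP[f [h [[h0 ch] ->]]]; have [->|f0] := eqVneq f 0.
  by left; rewrite rmorph0 mul0r.
right; exists f, h; split=> //; exists 1; first exact: oner_neq0.
rewrite content1 !mul_mod_ring; try exact: span_submodule; try exact: subD.
rewrite ch; apply: semistar_mono; [|exact/fg_Fbar/fg_ring|exact: content_sub].
by apply: fg_Fbar; exact: fg_content.
Qed.

Lemma star_ADD_Kr : star_ADD star -> Kr_in `<=` A.
Proof.
move=> addD x [->|[f [g [f0 g0 -> [h h0 starS]]]]]; first exact: (subring0 subA).
apply: Na_local => // M qM; have [t unif] := star_ADD_uniformizer addD qM.
exact: Kr_local unif f0 g0 h0 starS.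
Qed.

Lemma content_eq0 f g : content f `<=` content g -> g = 0 -> f = 0.
Proof.
move=> fg g0; apply/eqP; rewrite -lead_coef_eq0 -tofrac_eq0; apply/eqP.
suff g_0 : content g `<=` [set 0] by exact: (g_0 _ (fg _ (@content_coef D f (size f).-1))).
rewrite g0; apply: content_min => [|i]; last by rewrite coef0 rmorph0.
by case: (zero_prime subD) => -[].
Qed.

Lemma Kr_content_dvd f g : Kr_in `<=` A -> content f `<=` content g ->
  exists2 u, A u & tp f = u * tp g.
Proof.
move=> KrA fg; have [f0|f0] := eqVneq f 0.
  by exists 0; [exact: (subring0 subA)|rewrite f0 rmorph0 mul0r].
have g0 : g != 0 by apply: contra_neq f0; exact: content_eq0.
exists (tp f / tp g); first by apply: KrA; exact: Kr_content.
by rewrite divfK // tp_eq0.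
Qed.

(** Two generators are merged at a time. Up to units of the Nagata ring they are polynomials [f] and
    [g]; the content of the joined polynomial [F] contains both of theirs, so [f / F] and [g / F]
    are in [Kr_in], hence in the Nagata ring. Thus [F] generates the same ideal. *)
Lemma Kr_bezout : Kr_in `<=` A -> is_bezout A.
Proof.
move=> KrA; split=> // I [_ IA] [s IE].
have sA : [set` s] `<=` A by apply: subset_trans IA; rewrite IE; exact: subset_span.
rewrite IE {I IE IA}; elim: s sA => [_|x s IHs sA].
  exists 0; first exact: (subring0 subA).
  apply/seteqP; split; apply: span_min => //; try exact: span_submodule.
  by move=> _ ->; exact: (submodule0 (@span_submodule _ A _)).
have [|a Aa sE] := IHs.
  by move=> y ys; apply: sA; rewrite /= in_cons (ys : y \in s) orbT.
have [f [h [Nh xE]]] : exists f h, N h /\ x = tp f / tp h.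
  by apply/NaP/sA; rewrite /= mem_head.
have [g [k [Nk aE]]] := (NaP a).1 Aa.
have [h0 k0] := (Nstar_neq0 Nh, Nstar_neq0 Nk).
have inv_tp l : N l -> A (tp l)^-1.
  by move=> Nl; rewrite -[_^-1]mul1r -(rmorph1 tp); exact: Na_frac.
pose F := f + g * 'X^(size f).
have [fF gF] := coef_join g (leqnn (size f)).
have [u Au fu] := Kr_content_dvd KrA (content_mono fF).
have [v Av gv] := Kr_content_dvd KrA (content_mono gF).
exists (tp F); first exact: Na_poly.
have mS := @span_submodule _ A; apply/seteqP; split.
  have spanF z : A z -> span A [set tp F] (z * tp F).
    by move=> Az; apply: (submoduleM (mS _)) => //; exact: subset_span.
  have spanFx : span A [set tp F] x.
    by rewrite xE fu mulrAC; apply: spanF; apply: (subringM subA) => //; exact: inv_tp.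
  have spanFa : span A [set tp F] a.
    by rewrite aE gv mulrAC; apply: spanF; apply: (subringM subA) => //; exact: inv_tp.
  apply: span_min => // y /=; rewrite in_cons => /orP[/eqP->//|ys].
  have : span A [set a] y by rewrite -sE; exact: subset_span.
  by apply: span_min => // _ ->.
apply: span_min => // _ ->; rewrite /F rmorphD rmorphM.
have -> : tp f = tp h * x by rewrite xE mulrC divfK.
have -> : tp g = tp k * a by rewrite aE mulrC divfK.
apply: (submoduleD (mS _)).
  by apply: (submoduleM (mS _)); [exact: Na_poly|apply: subset_span; rewrite /= mem_head].
rewrite mulrAC; apply: (submoduleM (mS _)).
  by apply: (subringM subA); exact: Na_poly.
suff sub_cons : span A [set` s] `<=` span A [set` x :: s].
  by apply: sub_cons; rewrite sE; exact: subset_span.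
by apply: span_mono => y ys; rewrite /= in_cons (ys : y \in s) orbT.
Qed.

Lemma nagata_equivalence :
  [<-> star_ADD star;
       almost_dedekind A;
       [/\ A = Kr_in, almost_dedekind A & is_bezout A]]
  /\
  (almost_dedekind A <->
     is_field A \/
     [/\ krull_dim_is A 1, is_prufer A
       & forall J, is_maximal A J -> ~ idempotent_ideal A J]).
Proof.
(* Going back to [star_ADD] supplies the uniformizers in D on which the inclusion of [Kr_in]
   depends. The Prüfer property below is also drawn from here. *)
have add_bezout : almost_dedekind A -> A = Kr_in /\ is_bezout A.
  move=> adA; have KrA := star_ADD_Kr (Na_star_ADD adA).
  split; last exact: Kr_bezout.
  by apply/seteqP; split=> //; exact: Na_sub_Kr.
split.
  split; first exact: star_ADD_Na.
  split; last by case=> _ adA _; exact: Na_star_ADD.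
  by move=> adA; have [AKr bezA] := add_bezout adA.
split=> [adA|[fA|[dimA prufA nidA]]].
- have [fA|nfA] := pselect (is_field A); [by left|right].
  split; [exact: ADD_krull_dim|by apply: bezout_prufer => //; case: (add_bezout adA)|].
  move=> J maxJ; have [t unif] := ADD_uniformizer subA adA nfA maxJ.
  exact: (uniformizer_not_idempotent subA (maximal_prime subA maxJ) unif).
- by split=> //; left.
- exact: prufer_almost_dedekind Na_fraction dimA prufA nidA.
Qed.

End Nagata.

End SemistarAlmostDedekind.

Theorem theorem2p5 (D : idomainType) (hD : ~ GRing.field_axiom D)
    (star : semistar D) :
  [<-> star_ADD star;
       almost_dedekind (Na star);
       [/\ Na star = Kr star, almost_dedekind (Na star) & is_bezout (Na star)]]
  /\
  (almost_dedekind (Na star) <->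
     is_field (Na star) \/
     [/\ krull_dim_is (Na star) 1, is_prufer (Na star)
       & forall M, is_maximal (Na star) M -> ~ idempotent_ideal (Na star) M]).
Proof. exact: (@nagata_equivalence D star _ (@tofrac {poly D}) (@tofrac_eq0 _) (@fractionP _)). Qed.
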